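(* Consider the finite-template submatrix detection model (described in the context) under the standard consecutive placement family $\mathcal{K}^{\mathsf{con}}_{k,m,n}$, with entry laws $\{\mathcal{P}_{\ell,u}\}_{\ell\in[m],\,u\in[k]\times[k]}$ and null entry law $\mathcal{Q}=\mathcal{N}(0,1)$, and let $$\Theta^\star=\max_{\ell\in[m]}\frac{1}{m^2k^2}\log\left(\frac{1}{k^2}\sum_{u\in[k]\times[k]}\exp\left(m^2k^2\,\chi^2(\mathcal{P}_{\ell,u}\Vert\mathcal{Q})\right)\right).$$ Let $\delta=\delta_n>0$ be any sequence with $\delta_n\to0$ as $n\to\infty$. Assume $mk=o(n)$. If $$\Theta^\star\le\frac{1}{k^2}\log\left(1+\frac{n^2\log(1+\delta)}{4k^2m^2}\right),$$ then $d_{\mathsf{TV}}(\mathbb{P}_{\mathcal{H}_0},\mathbb{P}_{\mathcal{H}_1})=o(1)$, and detection is information-theoretically impossible.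
   Context: **Asymptotics.** All asymptotic statements are as $n\to\infty$; $m=m(n)$, $k=k(n)$ are positive integers with $mk\le n$, and the laws $\mathcal{P}_{\ell,u}$ may depend on $n$. $[k]=\{1,\dots,k\}$. **Blocks and placements.** $\mathcal{B}^{\mathsf{con}}_{k,n}$ is the set of $S\times T$ with $S,T\in\{\{i+1,\dots,i+k\}:i=0,\dots,n-k\}$. The standard consecutive placement family $\mathcal{K}^{\mathsf{con}}_{k,m,n}$ is the set of all unordered collections of $m$ pairwise disjoint blocks from $\mathcal{B}^{\mathsf{con}}_{k,n}$. For a block $B=S\times T$ with $S=\{s_1<\dots<s_k\}$, $T=\{t_1<\dots<t_k\}$, the coordinate map $\varphi_B:B\to[k]\times[k]$ is $\varphi_B(s_u,t_v)=(u,v)$. **Finite-template model.** For $\ell\in[m]$, $u\in[k]\times[k]$, $\mathcal{P}_{\ell,u}$ is a probability distribution on $\mathbb{R}$ with $\mathcal{P}_{\ell,u}\ll\mathcal{Q}$. (The two Gaussian specializations of interest are the mean-shift model $\mathcal{P}_{\ell,u}=\mathcal{N}((M_\ell)_u,1)$ with $M_\ell\in\mathbb{R}^{k\times k}$, and the variance-shift model $\mathcal{P}_{\ell,u}=\mathcal{N}(0,1+(\Sigma_\ell)_u)$ with $0\le(\Sigma_\ell)_u\le\vartheta_0$ for a fixed $\vartheta_0\in[0,1)$ independent of $n$.) One observes $X\in\mathbb{R}^{n\times n}$. Under $\mathcal{H}_0$ the entries are i.i.d. $\mathcal{Q}$ (law $\mathbb{P}_{\mathcal{H}_0}$). Under $\mathcal{H}_1$,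 $K$ is drawn uniformly from the placement family, then, conditional on $K$, a bijection $\beta:K\to[m]$ is drawn uniformly; given $(K,\beta)$ the entries of $X$ are independent with $X_{ij}\sim\mathcal{P}_{\beta(B),\varphi_B(i,j)}$ if $(i,j)\in B$ for some $B\in K$, and $X_{ij}\sim\mathcal{Q}$ otherwise. $\mathbb{P}_{\mathcal{H}_1}$ is the resulting marginal (mixture) law of $X$. **Divergences.** $\chi^2(\mathbb{P}\Vert\mathbb{Q})=\int(\mathrm{d}\mathbb{P}/\mathrm{d}\mathbb{Q}-1)^2\mathrm{d}\mathbb{Q}$ for $\mathbb{P}\ll\mathbb{Q}$, and $d_{\mathsf{TV}}(\mathbb{P},\mathbb{Q})=\frac12\int|\mathrm{d}\mathbb{P}-\mathrm{d}\mathbb{Q}|$. ''Detection is information-theoretically impossible'' means $d_{\mathsf{TV}}(\mathbb{P}_{\mathcal{H}_0},\mathbb{P}_{\mathcal{H}_1})=o(1)$, equivalently that the minimal risk $\inf_{\mathcal{A}}\{\mathbb{P}_{\mathcal{H}_0}(\mathcal{A}(X)=1)+\mathbb{P}_{\mathcal{H}_1}(\mathcal{A}(X)=0)\}$ over all tests tends to $1$. *)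

(* Defs.v *)
From HB Require Import structures.
From mathcomp Require Import all_boot all_order all_algebra.
From mathcomp Require Import all_classical all_reals all_analysis measurable_realfun.

Set Implicit Arguments.
Unset Strict Implicit.
Unset Printing Implicit Defensive.
Import Order.TTheory GRing.Theory Num.Theory.
Import numFieldNormedType.Exports.

Local Open Scope classical_set_scope.
Local Open Scope ring_scope.

Section mixture.
Context d (T : measurableType d) (R : realType) (I : finType).
Variables (A : {set I}) (mu : I -> {finite_measure set T -> \bar R}).
Local Open Scope ereal_scope.

(* The law obtained by first drawing [i] uniformly in [A]; it is the null
   measure (rather than a probability) when [A] is empty. *)
Definition mixture (U : set T) : \bar R :=
  (#|A|%:R^-1)%:E * \sum_(i in A) mu i U.

Let mixture0 : mixture set0 = 0.
Proof. by rewrite /mixture big1 ?mule0// => i _; rewrite measure0. Qed.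

Let weight_ge0 : 0 <= (#|A|%:R^-1)%:E :> \bar R.
Proof. by rewrite lee_fin invr_ge0 ler0n. Qed.

Let mixture_ge0 U : 0 <= mixture U.
Proof. by rewrite /mixture mule_ge0// sume_ge0. Qed.

Let mixture_semi_sigma_additive : semi_sigma_additive mixture.
Proof.
move=> F mF tF mUF; rewrite /mixture.
rewrite [X in X @ _ --> _](_ : _ = (fun n => (#|A|%:R^-1)%:E *
    \sum_(i in A) \sum_(0 <= j < n) mu i (F j))); last first.
  apply/funext => n; rewrite -ge0_sume_distrr; last first.
    by move=> *; exact: sume_ge0.
  by rewrite exchange_big.
apply: cvgeZl => //; apply: cvg_nnesum => // [i _|i _]; last first.
  exact: measure_semi_sigma_additive.
by near=> n; exact: sume_ge0.
Unshelve. all: by end_near. Qed.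

HB.instance Definition _ := isMeasure.Build _ _ _ mixture
  mixture0 mixture_ge0 mixture_semi_sigma_additive.

Let mixture_fin : fin_num_fun mixture.
Proof.
move=> U mU; rewrite /mixture fin_numM// sum_fin_num.
by apply/allP => x /mapP[i _ ->]; exact: fin_num_measure.
Qed.

HB.instance Definition _ := Measure_isFinite.Build _ _ _ mixture mixture_fin.

End mixture.

Section measure_add_finite.
Context d (T : measurableType d) (R : realType).
Variables mu nu : {finite_measure set T -> \bar R}.

HB.instance Definition _ := Measure.copy (measure_add mu nu)
  (msum (fun n => if n is 0%N then mu : {measure set T -> \bar R} else nu) 2).

Let measure_add_fin : fin_num_fun (measure_add mu nu).
Proof. by move=> U mU; rewrite measure_addE fin_numD !fin_num_measure. Qed.

HB.instance Definition _ :=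
  Measure_isFinite.Build _ _ _ (measure_add mu nu) measure_add_fin.

End measure_add_finite.

Definition std_normal (R : realType) : probability (measurableTypeR R) R :=
  normal_prob 0 1.

Section divergences.
Context d (T : measurableType d) (R : realType).
Local Open Scope ereal_scope.
Local Open Scope charge_scope.

(* Meaningful for [P `<< Q]; it may take the value [+oo]. *)
Definition chi2 (P Q : probability T R) : \bar R :=
  \int[Q]_x ('d (charge_of_finite_measure P) '/d Q x - 1) ^+ 2.

(* The densities are taken with respect to the dominating measure [P + Q]. *)
Definition dTV (P Q : {finite_measure set T -> \bar R}) : \bar R :=
  (2^-1)%:E * \int[measure_add P Q]_x
    `|'d (charge_of_finite_measure P) '/d (measure_add P Q) x
      - 'd (charge_of_finite_measure Q) '/d (measure_add P Q) x|.

Definition min_risk (P0 P1 : {finite_measure set T -> \bar R}) : \bar R :=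
  ereal_inf (range (fun A : {mfun T >-> bool} =>
    P0 (A @^-1` [set true]) + P1 (A @^-1` [set false]))).

End divergences.

Section product_laws.
Context (R : realType).
Local Notation TR := (measurableTypeR R).

Definition cons_pair n (p : TR * n.-tuple TR) : n.+1.-tuple TR :=
  [the n.+1.-tuple TR of p.1 :: p.2].

Let measurable_cons_pair n : measurable_fun setT (@cons_pair n).
Proof. exact: measurable_cons. Qed.

HB.instance Definition _ n :=
  isMeasurableFun.Build _ _ _ _ (@cons_pair n) (@measurable_cons_pair n).

Fixpoint tuple_law n :
    ('I_n -> probability TR R) -> probability (n.-tuple TR) R :=
  match n with
  | 0 => fun _ => dirac [tuple]
  | n'.+1 => fun mu =>
      distribution (mu ord0 \x tuple_law (fun i => mu (lift ord0 i)))%E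
        (@cons_pair n')
  end.

Definition entries_measurable n : set (set 'M[R]_n) :=
  \bigcup_(ij in [set: 'I_n * 'I_n])
    preimage_set_system setT (fun X : 'M[R]_n => X ij.1 ij.2 : TR) measurable.

(* R^(n x n) with its Borel (= product) sigma-algebra. *)
Definition obs n := g_sigma_algebraType (@entries_measurable n).

Definition mx_of_tuple n (t : #|{: 'I_n * 'I_n}|.-tuple TR) : obs n :=
  \matrix_(i, j) tnth t (enum_rank (i, j)).

Let measurable_mx_of_tuple n : measurable_fun setT (@mx_of_tuple n).
Proof.
apply: (@measurability _ _ _ (obs n) _ _ (@entries_measurable n)) => //.
move=> _ [_ [ij _ [B mB <-] <-]].
rewrite !setTI.
rewrite [X in measurable X](_ : _ = (fun t => tnth t (enum_rank ij)) @^-1` B).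
  by rewrite -[X in measurable X]setTI; exact: measurable_tnth.
by apply/seteqP; split => t /=; rewrite /mx_of_tuple mxE -surjective_pairing.
Qed.

HB.instance Definition _ n :=
  isMeasurableFun.Build _ _ _ _ (@mx_of_tuple n) (@measurable_mx_of_tuple n).

(* Law of the random matrix with independent entries X i j ~ mu (i, j);
   see [matrix_lawE]. *)
Definition matrix_law n (mu : 'I_n * 'I_n -> probability TR R) :
    probability (obs n) R :=
  distribution (tuple_law (fun q => mu (enum_val q))) (@mx_of_tuple n).

Lemma tuple_lawE n (mu : 'I_n -> probability TR R) (B : 'I_n -> set TR) :
  (forall i, measurable (B i)) ->
  tuple_law mu [set t | forall i, B i (tnth t i)] =
  (\prod_(i < n) mu i (B i))%E.
Proof.
elim: n mu B => [|n IH] mu B mB /=.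
  rewrite big_ord0 diracE mem_set//; by case.
rewrite big_ord_recl -IH// -product_measure1E//; last first.
  rewrite [X in measurable X](_ : _ =
      \bigcap_(i in [set: 'I_n]) ((fun t => tnth t i) @^-1` B (lift ord0 i))).
    apply: fin_bigcap_measurable => // i _.
    by rewrite -[X in measurable X]setTI; exact: measurable_tnth.
  by apply/seteqP; split => t /= h i; [move=> _|]; apply: h.
rewrite /distribution /pushforward; congr (_ _).
apply/seteqP; split => -[x t] /=.
  move=> h; split; first exact: (h ord0).
  by move=> i; have := h (lift ord0 i); rewrite tnthS.
move=> [h0 h] i; case: (unliftP ord0 i) => [j ->|->]; last exact: h0.
by rewrite tnthS; exact: h.
Qed.

Lemma matrix_lawE n (mu : 'I_n * 'I_n -> probability TR R)
    (B : 'I_n * 'I_n -> set TR) :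
  (forall ij, measurable (B ij)) ->
  matrix_law mu [set X : 'M[R]_n | forall i j, B (i, j) (X i j)] =
  (\prod_ij mu ij (B ij))%E.
Proof.
move=> mB; rewrite /matrix_law /distribution /pushforward.
transitivity (tuple_law (fun q : 'I_#|{: 'I_n * 'I_n}| => mu (enum_val q))
  [set t | forall q, B (enum_val q) (tnth t q)]).
  congr (tuple_law _ _); apply/seteqP; split => t /= h.
    move=> q; have := h (enum_val q).1 (enum_val q).2.
    by rewrite /mx_of_tuple mxE -surjective_pairing enum_valK.
  by move=> i j; rewrite /mx_of_tuple mxE; have := h (enum_rank (i, j));
    rewrite enum_rankK.
rewrite (tuple_lawE _ (fun q => mB (enum_val q)))//.
rewrite [RHS](reindex (fun q : 'I_#|{: 'I_n * 'I_n}| => enum_val q))//=.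
exists enum_rank => i _; [exact: enum_valK|exact: enum_rankK].
Qed.

End product_laws.

Section model.
Context (R : realType) (n m k : nat).
Local Notation TR := (measurableTypeR R).
Local Notation cell := ('I_n * 'I_n)%type.

(* Indices are 0-based: ['I_n], ['I_m], ['I_k] stand for {1,..,n}, {1,..,m},
   {1,..,k}. *)
Definition intervals : {set {set 'I_n}} :=
  [set [set x : 'I_n | (i <= x < i + k)%N] | i : 'I_n.+1 & (i + k <= n)%N]%SET.

Definition blocks_con : {set {set cell}} :=
  [set finset.setX S T | S in intervals, T in intervals]%SET.

Definition placements_con : {set {set {set cell}}} :=
  [set K : {set {set cell}} | [&& K \subset blocks_con, #|K| == m &
    [forall B in K, forall B' in K, (B != B') ==> [disjoint B & B']]]]%SET.

(* [enum S] lists [S] in increasing order, so that [index x (enum S)] is the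
   rank of [x] in [S]. For a [k * k] block the result is [None] only off
   its cells. *)
Definition block_coord (B : {set cell}) (ij : cell) : option ('I_k * 'I_k) :=
  match insub (index ij.1 (enum [set p.1 | p in B]%SET)),
        insub (index ij.2 (enum [set p.2 | p in B]%SET)) with
  | Some u, Some v => Some (u, v)
  | _, _ => None
  end.

Definition labelings (K : {set {set cell}}) :
    {set {ffun {B | B \in K} -> 'I_m}} :=
  [set b : {ffun {B | B \in K} -> 'I_m} |
    injectiveb b && [forall l, l \in codom b]]%SET.

Variables (Q : probability TR R) (P : 'I_m -> 'I_k * 'I_k -> probability TR R).

Definition entry_law (K : {set {set cell}}) (b : {ffun {B | B \in K} -> 'I_m})
    (ij : cell) : probability TR R :=
  if [pick B : {B | B \in K} | ij \in val B] is Some B then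
    if block_coord (val B) ij is Some u then P (b B) u else Q
  else Q.

Definition law_H0 : probability (obs R n) R := matrix_law (fun=> Q).

Definition law_H1 : {finite_measure set (obs R n) -> \bar R} :=
  mixture placements_con (fun K =>
    mixture (labelings K) (fun b => matrix_law (entry_law b))).

Definition Theta_star : \bar R :=
  (\big[maxe/-oo]_(l < m)
    (((m ^ 2 * k ^ 2)%:R^-1)%:E *
     lne (((k ^ 2)%:R^-1)%:E *
       \sum_(u : 'I_k * 'I_k)
         expeR ((m ^ 2 * k ^ 2)%:R%:E * chi2 (P l u) Q))))%E.

End model.

(* Main.v *)
(** Second moment method.  Let [L] be the likelihood ratio of [law_H1] against
    [law_H0]; it suffices that [E_0 L^2 -> 1].  Conditionally on two independent
    draws [(K, b)], [(K', b')], the second moment factorises over the cells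
    covered by both placements, and [2 st <= s^2 + t^2] (for the two centred
    densities, then for the two halves of the exponent) reduces it to
    [E exp (sum of chi2 over the cells of K covered by K')].  Jensen's
    inequality turns the bound on [Theta_star] into
    [sum_u chi2 (P l u) Q <= ln (1 + x)] for every template [l], so each block of
    [K] meeting [K'] costs at most a factor [1 + x], however many blocks of [K']
    it meets.  For fixed [K'] at most [4 k^2 m] positions meet [K'], and adding
    the blocks of [K] one at a time compares the resulting sum with the
    independent case: the mean is at most [((N + 4 k^2 m x) / (N - 4 k^2 m))^m],
    where [N = (n - k + 1)^2].  With [m k = o(n)] and the given [x], this tends
    to [1]. *)
Require Import Defs.
From HB Require Import structures.
From mathcomp Require Import all_boot all_order all_algebra.
From mathcomp Require Import zify ring lra.

Set Implicit Arguments.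
Unset Strict Implicit.
Unset Printing Implicit Defensive.
Import Order.TTheory GRing.Theory Num.Theory.
Local Open Scope ring_scope.

(** * Packings *)

Lemma ler_sum_subset (R : numDomainType) (I : finType) (A B : {set I})
    (F : I -> R) :
  A \subset B -> (forall i, i \in B -> 0 <= F i) ->
  \sum_(i in A) F i <= \sum_(i in B) F i.
Proof.
move=> AB F0; rewrite [leRHS](big_setID A)/= (setIidPr AB) lerDl.
by apply: sumr_ge0 => i; rewrite inE => /andP[_ /F0].
Qed.

Section packings.
Variables (V : finType) (D : {set V}) (e : rel V).
Hypothesis e_sym : symmetric e.

(** Abstract form of [placements_con]: [e] is compatibility, disjointness in the case of blocks. The
    guard [B != B'] matters there, since a nonempty block is not disjoint from itself. *)
Definition packings (j : nat) : {set {set V}} :=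
  [set K : {set V} | [&& K \subset D, #|K| == j &
    [forall B in K, forall B' in K, (B != B') ==> e B B']]].

Definition available (K : {set V}) : {set V} :=
  [set b in D | (b \notin K) && [forall B in K, e b B]].

Lemma packingsP j (K : {set V}) :
  reflect [/\ K \subset D, #|K| = j &
    forall B B', B \in K -> B' \in K -> B != B' -> e B B'] (K \in packings j).
Proof.
rewrite inE; apply: (iffP and3P) => -[KD Kj Ke]; split => //.
- exact/eqP.
- move=> B B' BK B'K BB'.
  by move/forall_inP : Ke => /(_ B BK)/forall_inP/(_ B' B'K)/implyP; exact.
- exact/eqP.
- apply/forall_inP => B BK; apply/forall_inP => B' B'K; apply/implyP.
  exact: Ke.
Qed.

Lemma packings_setD1 j (K : {set V}) b :
  K \in packings j.+1 -> b \in K -> K :\ b \in packings j.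
Proof.
move=> /packingsP[KD Kj Ke] bK; apply/packingsP; split.
- exact: subset_trans (subsetDl _ _) KD.
- by move: Kj; rewrite (cardsD1 b) bK => -[].
- by move=> B B' /setD1P[_ BK] /setD1P[_ B'K]; exact: Ke.
Qed.

Lemma packings_setU1 j (K : {set V}) b :
  K \in packings j -> b \in available K -> b |: K \in packings j.+1.
Proof.
move=> /packingsP[KD Kj Ke]; rewrite inE => /and3P[bD bK /forall_inP be].
apply/packingsP; split.
- by rewrite subUset sub1set bD.
- by rewrite cardsU1 bK Kj.
- move=> B B' /setU1P[->|BK] /setU1P[->|B'K]; rewrite ?eqxx// => BB'.
  + exact: be.
  + by rewrite e_sym be.
  + exact: Ke.
Qed.

(** Double counting of pairs [b \in K]: removing [b] leaves a packing of size [j], and forgetting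
    that [b] must be compatible with the rest only enlarges the sum of nonnegative terms. *)
Lemma sum_packingsS (R : numDomainType) (f : V -> R) j :
  (forall b, 0 <= f b) ->
  j.+1%:R * (\sum_(K in packings j.+1) \prod_(B in K) f B) <=
  (\sum_(b in D) f b) * \sum_(K in packings j) \prod_(B in K) f B.
Proof.
move=> f0.
have -> : j.+1%:R * (\sum_(K in packings j.+1) \prod_(B in K) f B) =
    \sum_(K in packings j.+1) \sum_(b in D | b \in K)
      f b * \prod_(B in K :\ b) f B.
  rewrite mulr_sumr; apply: eq_bigr => K /packingsP[KD Kj _].
  transitivity (\sum_(b in K) \prod_(B in K) f B).
    by rewrite sumr_const Kj mulr_natl.
  rewrite [RHS](eq_bigl (mem K)); last first.
    by move=> b /=; rewrite andb_idl// => /(subsetP KD).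
  by apply: eq_bigr => b bK; rewrite (big_setD1 b).
rewrite (exchange_big_dep (mem D))/=; last by move=> ? ? _ /andP[].
rewrite mulr_suml; apply: ler_sum => b bD.
rewrite -mulr_sumr ler_wpM2l//.
rewrite bD /=.
set A := [set K in packings j.+1 | b \in K].
rewrite (eq_bigl (mem A)); last by move=> K; rewrite !inE.
(* For fixed [b], [K :\ b] determines any [K] containing [b], so no packing of size [j] is counted
   twice. *)
rewrite -(big_imset (fun K' : {set V} => \prod_(B in K') f B)
  (h := fun K : {set V} => K :\ b))/=; last first.
  move=> K K'; rewrite /= !inE => /andP[_ bK] /andP[_ bK'] h.
  by rewrite -(setD1K bK) h setD1K.
apply: ler_sum_subset => [|K _]; last exact: prodr_ge0.
apply/subsetP => _ /imsetP[K KA ->].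
by move: KA; rewrite inE => /andP[? ?]; exact: packings_setD1.
Qed.

(** The same double count read in the other direction: every packing of size [j] has at least [F]
    extensions, and for fixed [b] distinct packings have distinct extensions by [b]. *)
Lemma card_packingsS (F j : nat) :
  (forall K, K \in packings j -> F <= #|available K|)%N ->
  (F * #|packings j| <= j.+1 * #|packings j.+1|)%N.
Proof.
move=> HF.
have -> : (j.+1 * #|packings j.+1| =
    \sum_(b : V) #|[set K in packings j.+1 | b \in K]|)%N.
  rewrite mulnC -sum_nat_const.
  under [RHS]eq_bigr do rewrite -sum1dep_card.
  rewrite (exchange_big_dep (mem (packings j.+1)))/=; last first.
    by move=> ? ? _ /andP[].
  apply: eq_bigr => K KP; have /packingsP[_ Kj _] := KP.
  rewrite -[LHS]Kj -sum1_card; apply: eq_bigl => b.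
  by rewrite KP.
apply: (@leq_trans (\sum_(b : V)
    #|[set K in packings j | b \in available K]|)%N); last first.
  apply: leq_sum => b _.
  rewrite -(card_in_imset (f := fun K : {set V} => b |: K)).
    apply: subset_leq_card; apply/subsetP => _ /imsetP[K KA ->].
    by move: KA; rewrite in_set => /andP[KP bK];
       rewrite in_set packings_setU1 ?setU11.
  move=> K K'; rewrite /= [in X in X -> _]in_set => /andP[_].
  rewrite in_set => /and3P[_ bK _]; rewrite in_set => /andP[_].
  rewrite in_set => /and3P[_ bK' _] h.
  by rewrite -(setU1K bK) h setU1K.
under eq_bigr do rewrite -sum1dep_card.
rewrite (exchange_big_dep (mem (packings j)))/=; last by move=> ? ? _ /andP[].
rewrite mulnC -sum_nat_const; apply: leq_sum => K KP.
apply: leq_trans (HF _ KP) _.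
rewrite -sum1_card leq_eqVlt; apply/orP; left; apply/eqP.
by apply: eq_bigl => b; rewrite KP.
Qed.

Lemma packings0 : set0 \in packings 0.
Proof.
by apply/packingsP; split; rewrite ?sub0set ?cards0// => B B'; rewrite inE.
Qed.

Section mean.
Variables (F m : nat).
Hypothesis F0 : (0 < F)%N.
Hypothesis HF : forall j K, (j < m)%N -> K \in packings j ->
  (F <= #|available K|)%N.

Lemma packings_gt0 j : (j <= m)%N -> (0 < #|packings j|)%N.
Proof.
elim: j => [_|j IH jm]; first by apply/card_gt0P; exists set0; exact: packings0.
have := card_packingsS (fun K => @HF j K jm).
have := IH (ltnW jm); nia.
Qed.

(** Each added member multiplies the weighted sum by at most [(\sum_(b in D) f b) / j.+1] and the
    count by at least [F / j.+1]. The factors [j.+1] cancel, so the mean is bounded as for [j]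
    independent members, with [F] in place of [#|D|]. *)
Lemma sum_packings_le (R : realFieldType) (f : V -> R) j :
  (forall b, 0 <= f b) -> (j <= m)%N ->
  \sum_(K in packings j) \prod_(B in K) f B <=
  ((\sum_(b in D) f b) / F%:R) ^+ j * #|packings j|%:R.
Proof.
move=> f0; elim: j => [_|j IH jm].
  rewrite expr0 mul1r -sumr_const.
  apply: ler_sum => K /packingsP[_ /eqP]; rewrite cards_eq0 => /eqP-> _.
  by rewrite big_set0.
have S0 : 0 <= \sum_(b in D) f b by exact: sumr_ge0.
have j0 : 0 < j.+1%:R :> R by rewrite ltr0n.
have F0' : 0 < F%:R :> R by rewrite ltr0n.
rewrite -(ler_pM2l j0); apply: le_trans (sum_packingsS _ f0) _.
apply: le_trans (ler_wpM2l S0 (IH (ltnW jm))) _.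
have -> : (\sum_(b in D) f b) *
    (((\sum_(b in D) f b) / F%:R) ^+ j * #|packings j|%:R) =
    ((\sum_(b in D) f b) / F%:R) ^+ j.+1 * (F * #|packings j|)%:R.
  rewrite exprS natrM; move: (_ ^+ j) => z; field; lra.
rewrite mulrCA -natrM ler_wpM2l ?exprn_ge0 ?divr_ge0 ?(ltW F0')//.
by rewrite ler_nat card_packingsS// => K; exact: HF.
Qed.

End mean.

Variable c : nat.
Hypothesis eirr : {in D, forall b, ~~ e b b}.
Hypothesis ec : {in D, forall B, (#|[set b in D | ~~ e b B]| <= c)%N}.

Lemma card_conflicts (K : {set V}) : K \subset D ->
  (#|[set b in D | [exists B in K, ~~ e b B]]| <= c * #|K|)%N.
Proof.
move=> KD.
apply: (@leq_trans (\sum_(B in K) #|[set b in D | ~~ e b B]|)%N); last first.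
  rewrite mulnC -sum_nat_const; apply: leq_sum => B BK.
  by apply: ec; exact: (subsetP KD).
have -> : [set b in D | [exists B in K, ~~ e b B]] =
    \bigcup_(B in K) [set b in D | ~~ e b B].
  apply/setP => b; rewrite inE; apply/andP/bigcupP => [[bD /exists_inP[B BK eb]]|].
    by exists B => //; rewrite inE bD.
  move=> [B BK]; rewrite inE => /andP[bD eb]; split => //.
  by apply/exists_inP; exists B.
apply: (big_ind2 (fun (A : {set V}) (s : nat) => #|A| <= s)%N) => //.
- by rewrite cards0.
- by move=> A s B t As Bt; apply: leq_trans (leq_card_setU A B) (leq_add As Bt).
Qed.

(** Each member of [K] excludes at most [c] elements of [D]. By [eirr] a member conflicts with
    itself, so the elements of [K] are among those excluded. *)
Lemma available_ge j (K : {set V}) : K \in packings j ->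
  (#|D| - c * j <= #|available K|)%N.
Proof.
move=> /packingsP[KD <- _].
have := card_conflicts KD; set H := [set b in D | _] => HK.
have HD : H \subset D by apply/subsetP => b; rewrite inE => /andP[].
have sub : D :\: H \subset available K.
  apply/subsetP => b /setDP[bD]; rewrite !inE bD/= => /exists_inPn h.
  apply/andP; split; last by apply/forall_inP => B /h; rewrite negbK.
  by apply/negP => /h; rewrite (eirr bD).
have := subset_leq_card sub; rewrite cardsD (setIidPr HD); lia.
Qed.

(* The weight [1 + x] on conflicting members is a product over the members, so
   [sum_packings_le] compares with [m] independent uniform members. *)
Lemma packings_mgf (R : realFieldType) (x : R) (m : nat) (K' : {set V}) :
  0 <= x -> (c * m < #|D|)%N -> K' \in packings m ->
  \sum_(K in packings m)
    (1 + x) ^+ #|[set B in K | [exists B' in K', ~~ e B B']]| <=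
  ((#|D|%:R + x * (c * m)%:R) / (#|D| - c * m)%:R) ^+ m * #|packings m|%:R.
Proof.
move=> x0 cm K'P.
set h := fun B => [exists B' in K', ~~ e B B'].
pose f B : R := if h B then 1 + x else 1.
have f0 B : 0 <= f B by rewrite /f; case: ifP => _; lra.
have F0 : (0 < #|D| - c * m)%N by lia.
have HF j (K : {set V}) : (j < m)%N -> K \in packings j ->
    (#|D| - c * m <= #|available K|)%N.
  move=> jm /available_ge; apply: leq_trans.
  by rewrite leq_sub2l// leq_mul2l (ltnW jm) orbT.
have := sum_packings_le F0 HF f0 (leqnn m).
rewrite [X in X <= _ -> _](_ : _ = \sum_(K in packings m)
    (1 + x) ^+ #|[set B in K | h B]|); last first.
  apply: eq_bigr => K _; rewrite /f -big_mkcondr/= -prodr_const.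
  by apply: eq_bigl => B; rewrite inE.
move=> /le_trans; apply; apply: ler_wpM2r => //.
apply: lerXn2r; rewrite ?nnegrE ?divr_ge0 ?sumr_ge0 ?addr_ge0 ?mulr_ge0//.
rewrite ler_wpM2r ?invr_ge0//.
(* The total weight exceeds [#|D|] by [x] for every element in conflict with [K'], and
   [card_conflicts] allows at most [c * m] of these. *)
have -> : \sum_(b in D) f b = #|D|%:R + x * #|[set b in D | h b]|%:R.
  have -> : x * #|[set b in D | h b]|%:R = \sum_(b in D | h b) x.
    rewrite sumr_const [RHS](_ : _ = x *+ #|[set b in D | h b]|) ?mulr_natr//.
    by congr (x *+ _); apply: eq_card => b; rewrite !inE.
  rewrite big_mkcondr/= -sumr_const -big_split/=.
  by apply: eq_bigr => b _; rewrite /f; case: ifP => _; rewrite ?addr0.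
rewrite lerD2l ler_wpM2l// ler_nat.
by have /packingsP[K'D <- _] := K'P; exact: card_conflicts.
Qed.

End packings.

(* Imported only here: classical sets shadow many finite-set names. *)
From mathcomp Require Import all_classical all_reals all_analysis measurable_realfun.
Import Order.TTheory GRing.Theory Num.Theory.
Import numFieldNormedType.Exports.
Local Open Scope classical_set_scope.
Local Open Scope ring_scope.

(** * Consecutive blocks *)

Section consecutive_blocks.
Variables n k : nat.
Hypotheses (k0 : (0 < k)%N) (kn : (k <= n)%N).
Local Notation cell := ('I_n * 'I_n)%type.

Let itv (i : 'I_n.+1) : {set 'I_n} := [set x : 'I_n | (i <= x < i + k)%N]%SET.
Let starts : {set 'I_n.+1} := [set i : 'I_n.+1 | (i + k <= n)%N]%SET.
Let blk (p : 'I_n.+1 * 'I_n.+1) : {set cell} :=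
  finset.setX (itv p.1) (itv p.2).

Let blocks_conE : blocks_con n k = (blk @: finset.setX starts starts)%SET.
Proof.
apply/setP => B; apply/imset2P/imsetP.
- move=> [S T /imsetP[i iA ->] /imsetP[j jA ->] ->].
  by exists (i, j); rewrite ?inE//=; move: iA jA; rewrite !inE => -> ->.
- move=> [[i j]]; rewrite inE/= => /andP[iA jA] ->.
  exists (itv i) (itv j) => //; apply: imset_f; by move: iA jA; rewrite !inE.
Qed.

Let start_in i : i \in starts -> exists2 x : 'I_n, x \in itv i & x = i :> nat.
Proof.
rewrite inE => ikn; have ilt : (i < n)%N by lia.
by exists (Ordinal ilt) => //; rewrite inE /=; lia.
Qed.

Let card_starts : #|starts| = (n - k).+1.
Proof.
have <- : #|'I_(n - k).+1| = (n - k).+1 by rewrite card_ord.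
have le : ((n - k).+1 <= n.+1)%N by lia.
rewrite -(card_imset _ (f := widen_ord le)); last first.
  by move=> i j /(congr1 val)/= /val_inj.
apply: eq_card => i; rewrite !inE; apply/idP/imsetP => [ikn|[j _ ->]]/=.
  have ilt : (i < (n - k).+1)%N by lia.
  by exists (Ordinal ilt) => //; apply: val_inj.
by have := ltn_ord j; lia.
Qed.

Let blk_inj : {in finset.setX starts starts &, injective blk}.
Proof.
(* The corner cell [(i, j)] lies in the first block, hence in the second, whose starts are therefore
   no larger. Exchanging the blocks gives equality. *)
have aux (i j i' j' : 'I_n.+1) : i \in starts -> j \in starts ->
    blk (i, j) = blk (i', j') -> (i' <= i)%N && (j' <= j)%N.
  move=> /start_in[x xi xE] /start_in[y yj yE] h.
  have : (x, y) \in blk (i, j) by rewrite inE/= xi yj.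
  by rewrite h !inE/=; lia.
move=> [i j] [i' j']; rewrite !finset.in_setX/= => /andP[iA jA] /andP[i'A j'A] h.
have /andP[h1 h2] := aux _ _ _ _ iA jA h.
have /andP[h3 h4] := aux _ _ _ _ i'A j'A (esym h).
by congr pair; apply: val_inj => /=; lia.
Qed.

Lemma card_blocks_con : #|blocks_con n k| = ((n - k).+1 ^ 2)%N.
Proof. by rewrite blocks_conE card_in_imset// cardsX card_starts mulnn. Qed.

Lemma block_con_neq0 B : B \in blocks_con n k -> ~~ [disjoint B & B].
Proof.
rewrite blocks_conE => /imsetP[[i j]]; rewrite finset.in_setX/= => /andP[iA jA] ->.
have [x xi _] := start_in iA; have [y yj _] := start_in jA.
by apply/negP => /disjointFr/(_ (_ : (x, y) \in _)); rewrite !finset.in_setX xi yj => /(_ isT).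
Qed.

(** Blocks sharing a cell have starts differing by less than [k] in each coordinate, which leaves at
    most [2 * k] choices per coordinate. *)
Lemma card_block_con_conflicts B : B \in blocks_con n k ->
  (#|[set b in blocks_con n k | ~~ [disjoint b & B]]%SET| <= 4 * k ^ 2)%N.
Proof.
rewrite blocks_conE => /imsetP[[i j] _ ->].
(* The subtraction is truncated at 0. For [i < k] the window is then [[0, 2k)], which still contains
   every start at distance less than [k]. *)
pose W (i : 'I_n.+1) := [set i' : 'I_n.+1 | (i - k <= i' < i - k + 2 * k)%N]%SET.
have cW i0 : (#|W i0| <= 2 * k)%N.
  rewrite -(size_iota (i0 - k) (2 * k)) cardE -(size_map val).
  apply: uniq_leq_size; first by rewrite map_inj_uniq ?enum_uniq//; exact: val_inj.
  by move=> x /mapP[y]; rewrite mem_enum inE => h ->; rewrite mem_iota.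
apply: (@leq_trans #|(blk @: finset.setX (W i) (W j))%SET|).
  apply: subset_leq_card; apply/fintype.subsetP => b; rewrite inE => /andP[].
  move=> /imsetP[[i' j'] _ ->] /pred0Pn[[x y]]; rewrite /= !inE /= => h.
  by apply: imset_f; rewrite !inE/=; lia.
apply: leq_trans (leq_imset_card _ _) _; rewrite cardsX.
by have := leq_mul (cW i) (cW j); lia.
Qed.

End consecutive_blocks.

Lemma placements_conE n m k :
  placements_con n m k =
  packings (blocks_con n k) (fun B B' : {set 'I_n * 'I_n} => [disjoint B & B']%B) m.
Proof. by []. Qed.

(** * Densities of product laws *)

(** [L] is real-valued and nonnegative everywhere, not only almost everywhere, so products of
    densities raise no question of null sets or infinite values. *)
Definition has_density d (T : measurableType d) (R : realType)
    (nu mu : {measure set T -> \bar R}) (L : T -> R) : Prop :=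
  [/\ measurable_fun setT L, forall x, 0 <= L x &
   forall F : T -> \bar R, measurable_fun setT F -> (forall x, (0 <= F x)%E) ->
     (\int[nu]_x F x = \int[mu]_x (F x * (L x)%:E))%E].

Section tuple_density.
Context (R : realType).
Local Notation TR := (measurableTypeR R).

(** Tonelli applied to the recursive definition of [tuple_law], with the first coordinate outermost.
    It drives the inductions on the number of coordinates below. *)
Lemma integral_tuple_lawS n (mu : 'I_n.+1 -> probability TR R)
    (F : n.+1.-tuple TR -> \bar R) :
  measurable_fun setT F -> (forall t, (0 <= F t)%E) ->
  (\int[tuple_law mu]_t F t =
   \int[mu ord0]_x \int[tuple_law (fun i => mu (lift ord0 i))]_t
     F (cons_pair (x, t)))%E.
transitivity (\int[distribution (mu ord0 \x
    tuple_law (fun i => mu (lift ord0 i))) (@cons_pair R n)]_t F t)%E => //.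
rewrite ge0_integral_distribution// fubini_tonelli1//=.
by apply: measurableT_comp => //; exact: measurable_funP.
Qed.

Lemma measurable_prod_tnth n (f : 'I_n -> TR -> R) :
  (forall i, measurable_fun setT (f i)) ->
  measurable_fun setT (fun t : n.-tuple TR => \prod_(i < n) f i (tnth t i)).
Proof.
move=> mf; apply: measurable_prod => i _.
by apply: measurableT_comp => //; exact: measurable_tnth.
Qed.

(** Induction on [n]: the induction hypothesis changes the measure in the inner integral, the
    density of the first coordinate changes it in the outer one, and that density is then moved
    inside. *)
Lemma tuple_law_density n (mu Q : 'I_n -> probability TR R)
    (l : 'I_n -> TR -> R) :
  (forall i, has_density (mu i) (Q i) (l i)) ->
  has_density (tuple_law mu) (tuple_law Q)
    (fun t => \prod_(i < n) l i (tnth t i)).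
Proof.
move=> h; have ml i : measurable_fun setT (l i) by case: (h i).
have l0 i x : 0 <= l i x by case: (h i).
split; [exact: measurable_prod_tnth|by move=> t; exact: prodr_ge0|].
elim: n mu Q l h ml l0 => [|n IH] mu Q l h ml l0 F mF F0.
  by apply: eq_integral => t _; rewrite big_ord0 mule1.
rewrite integral_tuple_lawS// integral_tuple_lawS//; last 2 first.
- apply: emeasurable_funM => //; apply/measurable_EFinP.
  exact: measurable_prod_tnth.
- by move=> t; rewrite mule_ge0// lee_fin prodr_ge0.
have mFc : measurable_fun setT (F \o @cons_pair R n).
  by apply: measurableT_comp => //; exact: measurable_funP.
have mprod : measurable_fun setT (fun z : TR * n.-tuple TR =>
    (\prod_(i < n) l (lift ord0 i) (tnth z.2 i))%:E).
  apply/measurable_EFinP.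
  apply: (measurableT_comp (measurable_prod_tnth (fun i => ml (lift ord0 i)))).
  exact: measurable_snd.
under eq_integral => x _.
  rewrite (IH _ (fun i => Q (lift ord0 i)) (fun i => l (lift ord0 i)))//;
    last exact: (measurableT_comp mFc (measurable_pair1 x)).
  over.
have [_ _ ->//] := h ord0; first last.
- by move=> x; apply: integral_ge0 => t _; rewrite mule_ge0// lee_fin prodr_ge0.
- apply: (measurable_fun_fubini_tonelli_F
    (fun z => (F (cons_pair z) *
      (\prod_(i < n) l (lift ord0 i) (tnth z.2 i))%:E)%E)) => //.
  + exact: emeasurable_funM.
  + by move=> z; rewrite mule_ge0// lee_fin prodr_ge0.
apply: eq_integral => x _; rewrite -ge0_integralZr//.
- apply: eq_integral => t _; rewrite -muleA -EFinM; congr (_ * _%:E)%E.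
  rewrite big_ord_recl mulrC; congr (_ * _).
  by apply: eq_bigr => i _; rewrite tnthS.
- apply: emeasurable_funM.
    exact: (measurableT_comp mFc (measurable_pair1 x)).
  apply/measurable_EFinP.
  exact: (measurable_prod_tnth (fun i => ml (lift ord0 i))).
- by move=> t _; rewrite mule_ge0// lee_fin prodr_ge0.
- by rewrite lee_fin.
Qed.

Lemma integral_tuple_law_prod n (Q : 'I_n -> probability TR R)
    (h : 'I_n -> TR -> R) :
  (forall i, measurable_fun setT (h i)) -> (forall i x, 0 <= h i x) ->
  (\int[tuple_law Q]_t (\prod_(i < n) h i (tnth t i))%:E =
   \prod_(i < n) \int[Q i]_x (h i x)%:E)%E.
Proof.
elim: n Q h => [|n IH] Q h mh h0.
  rewrite /= integral_dirac//; first by rewrite !big_ord0 diracT mul1e.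
  by apply/measurable_EFinP; exact: measurable_prod_tnth.
rewrite integral_tuple_lawS//; last 2 first.
- by apply/measurable_EFinP; exact: measurable_prod_tnth.
- by move=> t; rewrite lee_fin prodr_ge0.
rewrite big_ord_recl -IH//.
rewrite -ge0_integralZr//.
- apply: eq_integral => x _; rewrite -ge0_integralZl//.
  + apply: eq_integral => t _; rewrite -EFinM big_ord_recl/=; congr (_ * _)%:E.
    by apply: eq_bigr => i _; rewrite tnthS.
  + apply/measurable_EFinP.
    exact: (measurable_prod_tnth (fun i => mh (lift ord0 i))).
  + by move=> t _; rewrite lee_fin prodr_ge0.
  + by rewrite lee_fin.
- exact/measurable_EFinP.
- by move=> x _; rewrite lee_fin.
- by apply: integral_ge0 => t _; rewrite lee_fin prodr_ge0.
Qed.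

Definition mx_density n (l : 'I_n * 'I_n -> TR -> R) (X : obs R n) : R :=
  \prod_ij l ij ((X : 'M[R]_n) ij.1 ij.2).

Lemma measurable_entry n (ij : 'I_n * 'I_n) :
  measurable_fun setT (fun X : obs R n => (X : 'M[R]_n) ij.1 ij.2 : TR).
Proof.
move=> _ B mB; apply: sub_sigma_algebra; exists ij => //; exists B => //.
Qed.

Lemma measurable_mx_density n (l : 'I_n * 'I_n -> TR -> R) :
  (forall ij, measurable_fun setT (l ij)) ->
  measurable_fun setT (mx_density l).
Proof.
move=> ml; apply: measurable_prod => ij _.
by apply: (measurableT_comp (ml ij)); exact: measurable_entry.
Qed.

Lemma mx_density_tuple n (l : 'I_n * 'I_n -> TR -> R)
    (t : #|{: 'I_n * 'I_n}|.-tuple TR) :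
  mx_density l (mx_of_tuple t) = \prod_q l (enum_val q) (tnth t q).
Proof.
rewrite /mx_density (reindex (fun q : 'I_#|{: 'I_n * 'I_n}| => enum_val q))/=.
  apply: eq_bigr => q _.
  by rewrite /mx_of_tuple mxE -surjective_pairing enum_valK.
by exists enum_rank => i _; [exact: enum_valK|exact: enum_rankK].
Qed.

Lemma matrix_law_density n (mu Q : 'I_n * 'I_n -> probability TR R)
    (l : 'I_n * 'I_n -> TR -> R) :
  (forall ij, has_density (mu ij) (Q ij) (l ij)) ->
  has_density (matrix_law mu) (matrix_law Q) (mx_density l).
Proof.
move=> h; have ml i : measurable_fun setT (l i) by case: (h i).
have l0 i x : 0 <= l i x by case: (h i).
have mL := measurable_mx_density ml.
have L0 X : 0 <= mx_density l X by exact: prodr_ge0.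
split => // F mF F0.
have mFL : measurable_fun setT (fun X => (F X * (mx_density l X)%:E)%E).
  by apply: emeasurable_funM => //; exact/measurable_EFinP.
rewrite !ge0_integral_distribution//; last first.
  by move=> X; rewrite mule_ge0// lee_fin.
have [_ _ ->] := tuple_law_density
  (fun q : 'I_#|{: 'I_n * 'I_n}| => h (enum_val q)).
- by apply: eq_integral => t _ /=; rewrite mx_density_tuple.
- by apply: measurableT_comp => //; exact: measurable_funP.
- by move=> t /=.
Qed.

Lemma integral_matrix_law_prod n (Q : 'I_n * 'I_n -> probability TR R)
    (h : 'I_n * 'I_n -> TR -> R) :
  (forall i, measurable_fun setT (h i)) -> (forall i x, 0 <= h i x) ->
  (\int[matrix_law Q]_X (mx_density h X)%:E =
   \prod_ij \int[Q ij]_x (h ij x)%:E)%E.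
Proof.
move=> mh h0.
rewrite ge0_integral_distribution//; last 2 first.
- by apply/measurable_EFinP; exact: measurable_mx_density.
- by move=> X; rewrite lee_fin prodr_ge0.
under eq_integral => t _ do rewrite /= mx_density_tuple.
rewrite (integral_tuple_law_prod _
  (h := fun q : 'I_#|{: 'I_n * 'I_n}| => h (enum_val q)))//.
rewrite [RHS](reindex (fun q : 'I_#|{: 'I_n * 'I_n}| => enum_val q))//=.
by exists enum_rank => i _; [exact: enum_valK|exact: enum_rankK].
Qed.

End tuple_density.

(** * Mixtures and total variation *)

Section chi2_density.
Context d (T : measurableType d) (R : realType).
Local Open Scope charge_scope.

(** [chi2] uses the derivative of a charge, which agrees only almost everywhere with the
    sigma-finite version. The latter is finite and nonnegative everywhere, so it supplies [l], and
    the integral is transferred by almost-everywhere equality. *)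
Lemma radon_nikodym_density (P Q : probability T R) : P `<< Q ->
  exists2 l, has_density P Q l &
    (chi2 P Q = \int[Q]_x ((l x - 1) ^+ 2)%:E)%E.
Proof.
move=> PQ; pose f := Radon_Nikodym_SigmaFinite.f P Q.
have fE x : f x = (fine (f x))%:E.
  by rewrite fineK// Radon_Nikodym_SigmaFinite.f_fin_num.
have mf : measurable_fun setT f.
  exact: measurable_int (Radon_Nikodym_SigmaFinite.f_integrable PQ).
exists (fine \o f).
  split; first by apply: measurableT_comp.
    by move=> x; rewrite fine_ge0// Radon_Nikodym_SigmaFinite.f_ge0.
  move=> F mF F0; rewrite -(Radon_Nikodym_SigmaFinite.change_of_variables PQ)//.
  by apply: eq_integral => x _; rewrite -fE.
rewrite /chi2.
have E : ae_eq Q setT (fun x => ('d (charge_of_finite_measure P) '/d Q x - 1) ^+ 2)%E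
    (fun x => (((fine \o f) x - 1) ^+ 2)%:E).
  have := ae_eq_Radon_Nikodym_SigmaFinite PQ measurableT.
  apply: filterS => x /= h xT; rewrite -h//.
  by rewrite EFin_expe EFinB -fE.
apply: ae_eq_integral => //.
  under eq_fun do rewrite expe2.
  by apply: emeasurable_funM; apply: emeasurable_funB.
apply/measurable_EFinP; apply: measurable_funX.
by apply: measurable_funB => //; exact: measurableT_comp.
Qed.

Lemma density_integral1 (P Q : probability T R) l : has_density P Q l ->
  (\int[Q]_x (l x)%:E = 1)%E.
Proof.
move=> [_ _ h]; have := h (cst 1%E).
rewrite integral_cst// mul1e => h1.
transitivity (P setT); last exact: probability_setT.
by rewrite h1//; apply: eq_integral => x _; rewrite mul1e.
Qed.

(** Both densities have integral 1, so the integral of [l * l'] is 1 plus that of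
    [(l - 1) * (l' - 1)]. Taking the arithmetic mean of the two divergences keeps the bound
    additive, so that each placement can be charged separately. *)
Lemma integral_density_mul (P P' Q : probability T R) l l' (c c' : R) :
  has_density P Q l -> has_density P' Q l' ->
  (\int[Q]_x ((l x - 1) ^+ 2)%:E <= c%:E)%E ->
  (\int[Q]_x ((l' x - 1) ^+ 2)%:E <= c'%:E)%E ->
  (\int[Q]_x (l x * l' x)%:E <= (1 + (c + c') / 2)%:E)%E.
Proof.
move=> h h'; have [ml l0 _] := h; have [ml' l'0 _] := h'.
have i1 := density_integral1 h; have i1' := density_integral1 h'.
move=> ic ic'.
have mll : measurable_fun setT (fun x => (l x * l' x)%:E).
  by apply/measurable_EFinP; exact: measurable_funM.
have ms (f : T -> R) : measurable_fun setT f ->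
    measurable_fun setT (fun x => ((f x - 1) ^+ 2)%:E).
  move=> mf; apply/measurable_EFinP; apply: measurable_funX.
  exact: measurable_funB.
have sE (f : T -> R) : measurable_fun setT f ->
    (\int[Q]_x ((f x - 1) ^+ 2 / 2)%:E =
     2^-1%:E * \int[Q]_x ((f x - 1) ^+ 2)%:E)%E.
  move=> mf; rewrite -ge0_integralZl//.
  + by apply: eq_integral => x _; rewrite -EFinM mulrC.
  + exact: ms.
  + by move=> x _; rewrite lee_fin sqr_ge0.
have ms2 (f : T -> R) : measurable_fun setT f ->
    measurable_fun setT (fun x => ((f x - 1) ^+ 2 / 2)%:E).
  move=> mf; apply/measurable_EFinP; apply: measurable_funM => //.
  by apply/measurable_EFinP; exact: ms.
have g0 (f : T -> R) x : (0 <= ((f x - 1) ^+ 2 / 2)%:E)%E.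
  by rewrite lee_fin divr_ge0// sqr_ge0.
have mlE : measurable_fun setT (fun x => (l x)%:E) by exact/measurable_EFinP.
have ml'E : measurable_fun setT (fun x => (l' x)%:E) by exact/measurable_EFinP.
(* [(l - 1) (l' - 1) <= ((l - 1)^2 + (l' - 1)^2) / 2], with terms moved so that
   both sides are nonnegative. *)
have le : (\int[Q]_x ((l x * l' x)%:E + 1) <=
    \int[Q]_x (((l x - 1) ^+ 2 / 2)%:E + ((l' x - 1) ^+ 2 / 2)%:E
      + ((l x)%:E + (l' x)%:E)))%E.
  apply: ge0_le_integral => //.
  - by move=> x _; rewrite adde_ge0// lee_fin mulr_ge0.
  - exact: emeasurable_funD.
  - apply: emeasurable_funD; apply: emeasurable_funD => //; exact: ms2.
  - move=> x _; rewrite -!EFinD lee_fin.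
    have := sqr_ge0 (l x - l' x); nra.
move: le; rewrite !ge0_integralD//; first last.
- by move=> x _; rewrite lee_fin mulr_ge0.
- exact: emeasurable_funD.
- by move=> x _; rewrite adde_ge0// lee_fin.
- by apply: emeasurable_funD; exact: ms2.
- by move=> x _; rewrite adde_ge0.
- by move=> x _; rewrite lee_fin.
- by move=> x _; rewrite lee_fin.
- exact: ms2.
- exact: ms2.
rewrite integral_cst//= probability_setT mule1 !sE// i1 i1' => le.
rewrite -(@leeD2rE _ 1%E)//.
apply: le_trans le _.
apply: (@le_trans _ _ ((2^-1)%:E * c%:E + (2^-1)%:E * c'%:E + (1 + 1))%E).
  by rewrite leeD2r//; apply: leeD; apply: lee_wpmul2l => //; rewrite lee_fin.
by rewrite -!EFinM -!EFinD lee_fin; lra.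
Qed.

End chi2_density.

(** * Densities and second moments of mixtures *)

Section set_density.
Context d (T : measurableType d) (R : realType).
Implicit Types mu nu : {measure set T -> \bar R}.

(* Weaker than [has_density]: enough for mixtures, whereas the passage to product
   laws by Tonelli needs the change of variables for all nonnegative [F]. *)
Definition set_density nu mu (L : T -> R) : Prop :=
  [/\ measurable_fun setT L, forall x, 0 <= L x &
   forall U, measurable U -> (nu U = \int[mu]_(x in U) (L x)%:E)%E].

Lemma has_density_set nu mu L : has_density nu mu L -> set_density nu mu L.
Proof.
move=> [mL L0 h]; split => // U mU.
have := h (EFin \o \1_U); rewrite integral_indic// setIT => ->//.
- rewrite [RHS]integral_mkcond; apply: eq_integral => x _ /=.
  rewrite muleC epatch_indic//.
- by apply/measurable_EFinP; exact: measurable_indic.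
- by move=> x; rewrite /= lee_fin.
Qed.

Variable I : finType.
Implicit Types (A B : {set I}) (L : I -> T -> R).

Definition avg A (f : I -> R) : R := #|A|%:R^-1 * \sum_(i in A) f i.

Lemma measurable_sum_in A (U : set T) L :
  (forall i, measurable_fun U (L i)) ->
  measurable_fun U (fun x => \sum_(i in A) L i x).
Proof.
move=> mL; under eq_fun do rewrite -big_enum/=.
exact: measurable_sum.
Qed.

Lemma ge0_integral_sum_in mu A (U : set T) L : measurable U ->
  (forall i, measurable_fun U (L i)) -> (forall i x, 0 <= L i x) ->
  (\int[mu]_(x in U) (\sum_(i in A) L i x)%:E =
   \sum_(i in A) \int[mu]_(x in U) (L i x)%:E)%E.
Proof.
move=> mU mL L0; under eq_integral do rewrite -sumEFin -big_enum/=.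
rewrite ge0_integral_sum//; first by rewrite big_enum.
- by move=> i; exact/measurable_EFinP.
- by move=> i x _; rewrite lee_fin.
Qed.

Lemma ge0_integral_avg mu A (U : set T) L : measurable U ->
  (forall i, measurable_fun U (L i)) -> (forall i x, 0 <= L i x) ->
  (\int[mu]_(x in U) (avg A (fun i => L i x))%:E =
   (#|A|%:R^-1)%:E * \sum_(i in A) \int[mu]_(x in U) (L i x)%:E)%E.
Proof.
move=> mU mL L0; rewrite -ge0_integral_sum_in// -ge0_integralZl//.
- by apply/measurable_EFinP; exact: measurable_sum_in.
- by move=> x _; rewrite lee_fin sumr_ge0.
Qed.

Lemma avg_ge0 A f : (forall i, 0 <= f i) -> 0 <= avg A f.
Proof. by move=> f0; rewrite mulr_ge0 ?invr_ge0// sumr_ge0. Qed.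

Lemma measurable_avg A L : (forall i, measurable_fun setT (L i)) ->
  measurable_fun setT (fun x => avg A (fun i => L i x)).
Proof. by move=> mL; apply: measurable_funM => //; exact: measurable_sum_in. Qed.

Lemma mixture_density (nu : I -> {finite_measure set T -> \bar R}) mu A L :
  (forall i, set_density (nu i) mu (L i)) ->
  set_density (mixture A nu) mu (fun x => avg A (fun i => L i x)).
Proof.
move=> h; have mL i : measurable_fun setT (L i) by case: (h i).
have L0 i x : 0 <= L i x by case: (h i).
split; [exact: measurable_avg|by move=> x; exact: avg_ge0|].
move=> U mU; rewrite ge0_integral_avg//; last first.
  by move=> i; exact: measurable_funTS.
congr (_ * _)%E; apply: eq_bigr => i _.
by have [_ _ ->] := h i.
Qed.

Lemma mixture_prob (nu : I -> {finite_measure set T -> \bar R}) A :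
  (0 < #|A|)%N -> (forall i, i \in A -> nu i setT = 1%E) ->
  mixture A nu setT = 1%E.
Proof.
move=> A0 h; rewrite /mixture (eq_bigr (fun=> 1%:E)) => [|i /h //].
rewrite sumEFin sumr_const -EFinM mulVf//.
by rewrite pnatr_eq0 -lt0n.
Qed.

End set_density.

(** Bilinear expansion of the product of two averages. The index types differ because the labelings
    of two placements have different types; the lemma serves once for placements and once for
    labelings. *)
Lemma avg_second_moment d (T : measurableType d) (R : realType) (I J : finType)
    (mu : {measure set T -> \bar R}) (A : {set I}) (B : {set J})
    (L : I -> T -> R) (L' : J -> T -> R) (g : I -> J -> R) :
  (forall i, measurable_fun setT (L i)) -> (forall i x, 0 <= L i x) ->
  (forall j, measurable_fun setT (L' j)) -> (forall j x, 0 <= L' j x) ->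
  (forall i j, i \in A -> j \in B ->
    (\int[mu]_x (L i x * L' j x)%:E <= (g i j)%:E)%E) ->
  (\int[mu]_x (avg A (fun i => L i x) * avg B (fun j => L' j x))%:E <=
   (avg A (fun i => avg B (g i)))%:E)%E.
Proof.
move=> mL L0 mL' L'0 h.
under eq_integral => x _.
  have -> : avg A (fun i => L i x) * avg B (fun j => L' j x) =
      avg A (fun i => avg B (fun j => L i x * L' j x)).
    rewrite {1}/avg -mulrA mulr_suml; congr (_ * _); apply: eq_bigr => i _.
    by rewrite /avg mulrCA mulr_sumr.
  over.
have mLL i j : measurable_fun setT (fun x => L i x * L' j x).
  exact: measurable_funM.
have LL0 i j x : 0 <= L i x * L' j x by exact: mulr_ge0.
have Ainv (K : finType) (C : {set K}) : (0 <= (#|C|%:R^-1)%:E :> \bar R)%E.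
  by rewrite lee_fin invr_ge0.
rewrite (ge0_integral_avg _ _ (L := fun i x => avg B (fun j => L i x * L' j x)))//;
  last 2 first.
- by move=> i; apply: measurable_avg => j; exact: mLL.
- by move=> i x; exact: avg_ge0.
rewrite [in leRHS]/avg EFinM lee_wpmul2l//= -sumEFin.
apply: lee_sum => i iA.
rewrite (ge0_integral_avg _ _ (L := fun j x => L i x * L' j x))//.
rewrite /avg EFinM lee_wpmul2l//= -sumEFin.
by apply: lee_sum => j jB; exact: h.
Qed.

(** * From a second moment to total variation and risk *)

Section total_variation.
Context d (T : measurableType d) (R : realType).

(** The integral of [(L - 1) ^+ 2] is the second moment minus 1, hence at most [s]. It controls the
    integral of [|L - 1|], which bounds the discrepancy on every set at once. *)
Lemma set_density_close (P0 : probability T R)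
    (P1 : {finite_measure set T -> \bar R}) (L : T -> R) (s eta : R) :
  set_density P1 P0 L -> P1 setT = 1%E -> 0 < eta ->
  (\int[P0]_x (L x * L x)%:E <= (1 + s)%:E)%E ->
  forall U, measurable U ->
    (P1 U <= P0 U + ((eta + s / eta) / 2)%:E)%E /\
    (P0 U <= P1 U + ((eta + s / eta) / 2)%:E)%E.
Proof.
move=> [mL L0 P1E] P1T eta0 hL U mU.
pose sq x := (L x - 1) ^+ 2.
have msq : measurable_fun setT sq.
  by apply: measurable_funX; exact: measurable_funB.
have sq0 x : 0 <= sq x by exact: sqr_ge0.
have mLL : measurable_fun setT (fun x => L x * L x) by exact: measurable_funM.
have sqle : (\int[P0]_x (sq x)%:E <= s%:E)%E.
  (* The identity [(L - 1)^2 + 2 L = L^2 + 1], arranged so that all integrands are nonnegative and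
     no extended reals are subtracted. *)
  have E : (\int[P0]_x (sq x)%:E + (\int[P0]_x (L x)%:E + \int[P0]_x (L x)%:E) =
      \int[P0]_x (L x * L x)%:E + \int[P0]_x 1)%E.
    rewrite -!ge0_integralD//.
    - by apply: eq_integral => x _; rewrite -!EFinD; congr EFin; rewrite /sq; ring.
    - by move=> x _; rewrite lee_fin mulr_ge0.
    - exact/measurable_EFinP.
    - by move=> x _; rewrite lee_fin.
    - exact/measurable_EFinP.
    - by move=> x _; rewrite adde_ge0// lee_fin.
    - by apply: emeasurable_funD; exact/measurable_EFinP.
    - by move=> x _; rewrite lee_fin.
    - exact/measurable_EFinP.
    - by move=> x _; rewrite lee_fin.
    - exact/measurable_EFinP.
  have IL : (\int[P0]_x (L x)%:E = 1)%E by rewrite -P1T; exact/esym/P1E.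
  move: E; rewrite IL integral_cst//= probability_setT mule1 => E.
  rewrite -(@leeD2rE _ (1 + 1)%E)// E.
  apply: le_trans (leeD2r 1%E hL) _.
  by rewrite -!EFinD lee_fin; lra.
(* AM-GM: [|L - 1| <= g], a substitute for Cauchy-Schwarz. *)
pose g x := eta / 2 + sq x / (2 * eta).
have eta0' : 0 <= eta by exact: ltW.
have g0 x : 0 <= g x.
  by rewrite /g addr_ge0// divr_ge0// ?mulr_ge0.
have mg : measurable_fun setT g.
  by apply: measurable_funD => //; exact: measurable_funM.
have gle : (\int[P0]_(x in U) (g x)%:E <= ((eta + s / eta) / 2)%:E)%E.
  apply: (@le_trans _ _ (\int[P0]_x (g x)%:E)%E).
    apply: ge0_subset_integral => //.
    - exact/measurable_EFinP.
    - by move=> x _; rewrite lee_fin.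
  under eq_integral do rewrite EFinD.
  rewrite ge0_integralD//; last 3 first.
  - by move=> x _; rewrite lee_fin divr_ge0.
  - by move=> x _; rewrite lee_fin divr_ge0// mulr_ge0.
  - by apply/measurable_EFinP; exact: measurable_funM.
  rewrite integral_cst//= probability_setT mule1.
  have -> : (\int[P0]_x (sq x / (2 * eta))%:E =
      ((2 * eta)^-1)%:E * \int[P0]_x (sq x)%:E)%E.
    rewrite -ge0_integralZl//.
    - by apply: eq_integral => x _; rewrite -EFinM mulrC.
    - exact/measurable_EFinP.
    - by move=> x _; rewrite lee_fin.
    - by rewrite lee_fin invr_ge0 mulr_ge0.
  apply: (@le_trans _ _ ((eta / 2)%:E + ((2 * eta)^-1)%:E * s%:E)%E).
    apply: leeD2l; apply: lee_wpmul2l => //.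
    by rewrite lee_fin invr_ge0 mulr_ge0.
  rewrite -EFinM -EFinD.
  have -> // : eta / 2 + (2 * eta)^-1 * s = (eta + s / eta) / 2.
  by field; rewrite gt_eqF.
have P0E : P0 U = (\int[P0]_(x in U) 1)%E by rewrite integral_cst// mul1e.
have mU' (f : T -> R) : measurable_fun setT f ->
    measurable_fun U (fun x => (f x)%:E).
  by move=> mf; apply/measurable_EFinP; exact: measurable_funTS.
have main x : L x - 1 <= g x /\ 1 - L x <= g x.
  have gE : g x - `|L x - 1| = (`|L x - 1| - eta) ^+ 2 / (2 * eta).
    rewrite /g /sq -[(L x - 1) ^+ 2]real_normK ?num_real//.
    by field; rewrite gt_eqF.
  have : 0 <= g x - `|L x - 1|.
    by rewrite gE divr_ge0 ?sqr_ge0// mulr_ge0.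
  by have := ler_norm (L x - 1); have := ler_norm (1 - L x); rewrite (distrC 1); lra.
rewrite P1E// P0E; split.
- apply: le_trans (leeD2l _ gle); rewrite -ge0_integralD//; last 2 first.
  + by move=> x _; rewrite lee_fin.
  + exact: mU'.
  apply: ge0_le_integral => //.
  + by move=> x _; rewrite lee_fin.
  + exact: mU'.
  + by apply: emeasurable_funD => //; exact: mU'.
  + by move=> x _; rewrite -EFinD lee_fin; have := main x; lra.
- apply: le_trans (leeD2l _ gle); rewrite -ge0_integralD//; last 4 first.
  + by move=> x _; rewrite lee_fin.
  + exact: mU'.
  + by move=> x _; rewrite lee_fin.
  + exact: mU'.
  apply: ge0_le_integral => //.
  + by apply: emeasurable_funD => //; exact: mU'.
  + by move=> x _; rewrite -EFinD lee_fin; have := main x; lra.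
Qed.

Variables (P0 P1 : {finite_measure set T -> \bar R}) (c : R).
Hypothesis close : forall U, measurable U ->
  (P1 U <= P0 U + c%:E)%E /\ (P0 U <= P1 U + c%:E)%E.

Lemma dTV_ge0 : (0 <= dTV P0 P1)%E.
Proof.
by rewrite /dTV mule_ge0 ?lee_fin ?invr_ge0//; apply: integral_ge0.
Qed.

Lemma dTV_le : (dTV P0 P1 <= c%:E)%E.
Proof.
pose M := measure_add P0 P1.
have dom0 : P0 `<< M.
  apply/null_content_dominatesP => U mU; rewrite /M /= measure_addE => /eqP.
  by rewrite padde_eq0// => /andP[/eqP].
have dom1 : P1 `<< M.
  apply/null_content_dominatesP => U mU; rewrite /M /= measure_addE => /eqP.
  by rewrite padde_eq0// => /andP[_ /eqP].
rewrite /dTV -/M.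
set f0 := Radon_Nikodym _ _; set f1 := Radon_Nikodym _ _.
have if0 : M.-integrable setT f0 by exact: Radon_Nikodym_integrable.
have if1 : M.-integrable setT f1 by exact: Radon_Nikodym_integrable.
have mf0 : measurable_fun setT f0 by exact: measurable_int if0.
have mf1 : measurable_fun setT f1 by exact: measurable_int if1.
(* On [A] and on its complement the sign of [f0 - f1] is constant, so the integral of its absolute
   value splits into two differences of measures, each at most [c]; the factor 1/2 then gives
   [c]. *)
pose A := [set x | (f0 x <= f1 x)%E].
have mA : measurable A.
  by rewrite -[A]setTI; exact: measurable_lee.
have E0 U : measurable U -> P0 U = (\int[M]_(x in U) f0 x)%E.
  by move=> mU; rewrite -Radon_Nikodym_integral.
have E1 U : measurable U -> P1 U = (\int[M]_(x in U) f1 x)%E.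
  by move=> mU; rewrite -Radon_Nikodym_integral.
have fin0 x : f0 x \is a fin_num by exact: Radon_Nikodym_fin_num.
have fin1 x : f1 x \is a fin_num by exact: Radon_Nikodym_fin_num.
have mabs : measurable_fun setT (fun x => `|f0 x - f1 x|)%E.
  by apply: measurableT_comp => //; exact: emeasurable_funB.
rewrite -(setUv A) ge0_integral_setU//; last 3 first.
- exact: measurableC.
- by rewrite setUv.
- by apply/disj_setPCl.
have -> : (\int[M]_(x in A) `|f0 x - f1 x| = P1 A - P0 A)%E.
  rewrite E0// E1// -integralB//; [|exact: integrableS if1|exact: integrableS if0].
  apply: eq_integral => x; rewrite inE => xA.
  by rewrite lee0_abs ?sube_le0// fin_num_oppeB ?fin1// addeC.
have -> : (\int[M]_(x in ~` A) `|f0 x - f1 x| = P0 (~` A) - P1 (~` A))%E.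
  have mA' := measurableC mA.
  rewrite E0// E1// -integralB//; [|exact: integrableS if0|exact: integrableS if1].
  apply: eq_integral => x; rewrite inE => /negP; rewrite -ltNge => xA.
  by rewrite gee0_abs// sube_ge0 ?(ltW xA)// fin1.
have [h1 _] := close mA; have [_ h2] := close (measurableC mA).
apply: (@le_trans _ _ ((2^-1)%:E * (c%:E + c%:E))%E).
  apply: lee_wpmul2l; first by rewrite lee_fin invr_ge0.
  apply: leeD.
  - by rewrite leeBlDl ?fin_num_measure.
  - by rewrite leeBlDl ?fin_num_measure//; exact: measurableC.
by rewrite -EFinD -EFinM lee_fin; lra.
Qed.

Hypotheses (P0T : P0 setT = 1%E) (P1T : P1 setT = 1%E).

Lemma min_risk_le1 : (min_risk P0 P1 <= 1)%E.
Proof.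
(* The test that never rejects the null hypothesis has risk 1. *)
pose A : {mfun T >-> bool} := cst false.
apply: (@le_trans _ _ (P0 (A @^-1` [set true]) + P1 (A @^-1` [set false])))%E.
  by apply: ereal_inf_lbound; exists A.
rewrite (_ : A @^-1` [set true] = set0); last by apply/seteqP; split.
rewrite (_ : A @^-1` [set false] = setT); last by apply/seteqP; split.
by rewrite measure0 P1T add0e.
Qed.

Lemma min_risk_ge : ((1 - c)%:E <= min_risk P0 P1)%E.
Proof.
apply: le_ereal_inf_tmp => _ [A _ <-].
have mA : measurable (A @^-1` [set true]).
  by rewrite -[X in measurable X]setTI; exact: (measurable_funP A).
have -> : A @^-1` [set false] = ~` (A @^-1` [set true]).
  by apply/seteqP; split => x /=; case: (A x).
have [h _] := close mA.
have E : (P1 (A @^-1` [set true]) + P1 (~` (A @^-1` [set true])) = 1)%E.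
  rewrite -measureU ?setUv//; first exact: measurableC.
  by rewrite setICr.
rewrite EFinB leeBlDr// -E [leRHS]addeAC.
by rewrite leeD2r.
Qed.

End total_variation.

(** * Second moment of the likelihood ratio *)

Lemma ler_mul_mean_sqr (R : realFieldType) (u v p r : R) :
  u ^+ 2 <= p -> v ^+ 2 <= r -> u * v <= (p + r) / 2.
Proof. by move=> up vr; have := sqr_ge0 (u - v); nra. Qed.

Lemma chi2_ge0 d (T : measurableType d) (R : realType) (P Q : probability T R) :
  (0 <= chi2 P Q)%E.
Proof.
apply: integral_ge0 => x _; rewrite expe2.
by case: (_ - _)%E => [r| |]//; rewrite -EFinM lee_fin -expr2 sqr_ge0.
Qed.

(** The tangent to [expR] at the mean lies below it; averaging the tangent bounds makes the linear
    terms cancel. *)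
Lemma expR_jensen (R : realType) (I : finType) (f : I -> R) : (0 < #|I|)%N ->
  expR (#|I|%:R^-1 * \sum_i f i) <= #|I|%:R^-1 * \sum_i expR (f i).
Proof.
move=> I0; have I0' : #|I|%:R != 0 :> R by rewrite pnatr_eq0 -lt0n.
set mu := _ * \sum_i f i.
have tangent i : expR mu * (1 + (f i - mu)) <= expR (f i).
  rewrite -[in leRHS](subrKC mu (f i)) expRD ler_wpM2l ?expR_ge0//.
  exact: expR_ge1Dx.
apply: (@le_trans _ _ (#|I|%:R^-1 * \sum_i (expR mu * (1 + (f i - mu))))); last first.
  by rewrite ler_wpM2l ?invr_ge0// ler_sum.
rewrite -mulr_sumr big_split/= sumrB !sumr_const.
have -> : \sum_i f i = mu * #|I|%:R by rewrite /mu mulrAC mulVf// mul1r.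
by rewrite -(mulr_natr mu) subrr addr0 mulrCA mulVf// mulr1.
Qed.

(** Jensen bounds the mean divergence of each template by the exponential average defining
    [Theta_star]; the scale [m ^ 2 * k ^ 2] cancels. Real values [ch] replace the extended ones from
    here on. *)
Lemma Theta_star_chi2 (R : realType) (m k : nat)
    (Q : probability (measurableTypeR R) R)
    (P : 'I_m -> 'I_k * 'I_k -> probability (measurableTypeR R) R) (a : R) :
  (0 < m)%N -> (0 < k)%N -> (Theta_star Q P <= a%:E)%E ->
  exists ch : 'I_m -> 'I_k * 'I_k -> R,
    [/\ forall l u, 0 <= ch l u, forall l u, chi2 (P l u) Q = (ch l u)%:E &
     forall l, \sum_u ch l u <= (k ^ 2)%:R * a].
Proof.
move=> m0 k0 Ha.
set N : R := (m ^ 2 * k ^ 2)%:R.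
have N0 : 0 < N by rewrite ltr0n muln_gt0 !expn_gt0 m0 k0.
set c2 : R := (k ^ 2)%:R^-1.
have k20 : 0 < (k ^ 2)%:R :> R by rewrite ltr0n expn_gt0 k0.
have c20 : 0 < c2 by rewrite invr_gt0.
have bound l : (c2%:E * \sum_(u : 'I_k * 'I_k) expeR (N%:E * chi2 (P l u) Q)
    <= (expR (N * a))%:E)%E.
  have S0 : (0 <= c2%:E *
      \sum_(u : 'I_k * 'I_k) expeR (N%:E * chi2 (P l u) Q))%E.
    apply: mule_ge0; first by rewrite lee_fin ltW.
    by apply: sume_ge0 => u _; exact: expeR_ge0.
  have := S0; rewrite -lneK_eq => /eqP <-.
  rewrite -[(expR _)%:E]/(expeR (N * a)%:E) lee_expeR.
  have : ((N^-1)%:E * lne (c2%:E *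
      \sum_(u : 'I_k * 'I_k) expeR (N%:E * chi2 (P l u) Q)) <= a%:E)%E.
    apply: le_trans Ha; rewrite /Theta_star.
    exact: (le_bigmax _ (fun l => (N^-1)%:E * lne (c2%:E *
      \sum_(u : 'I_k * 'I_k) expeR (N%:E * chi2 (P l u) Q)))%E l).
  by rewrite lee_pdivrMl// EFinM.
(* One infinite divergence would make the whole exponential average infinite, against the finite
   [bound]. *)
have fin l u : chi2 (P l u) Q \is a fin_num.
  rewrite ge0_fin_numE ?chi2_ge0// ltey; apply/negP => /eqP h.
  have := bound l; rewrite leNgt => /negP; apply.
  rewrite (bigD1 u)//= h gt0_muley ?lte_fin//= addye; last first.
    rewrite gt_eqF// (@lt_le_trans _ _ 0%E)//.
    by apply: sume_ge0 => v _; exact: expeR_ge0.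
  by rewrite gt0_muley ?lte_fin// ltry.
exists (fun l u => fine (chi2 (P l u) Q)); split.
- by move=> l u; rewrite fine_ge0// chi2_ge0.
- by move=> l u; rewrite fineK.
- move=> l; have := bound l.
  under eq_bigr => u _ do rewrite -(fineK (fin l u)) -EFinM /=.
  rewrite sumEFin -EFinM lee_fin => h.
  have cardE : #|{: 'I_k * 'I_k}| = (k ^ 2)%N by rewrite card_prod !card_ord mulnn.
  have := @expR_jensen R _ (fun u : 'I_k * 'I_k => N * fine (chi2 (P l u) Q)).
  rewrite cardE expn_gt0 k0 => /(_ isT)/le_trans/(_ h).
  rewrite ler_expR -mulr_sumr mulrCA ler_pM2l// /c2.
  by rewrite ler_pdivrMl.
Qed.

Section model_second_moment.
Context (R : realType) (n m k : nat).
Local Notation TR := (measurableTypeR R).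
Local Notation cell := ('I_n * 'I_n)%type.

(* The case distinction of [entry_law], so that entry densities and entry
   chi-square divergences are indexed exactly as the entry laws are. *)
Definition entry_case (A : Type) (q : A) (p : 'I_m -> 'I_k * 'I_k -> A)
    (K : {set {set cell}}) (b : {ffun {B | B \in K} -> 'I_m}) (ij : cell) : A :=
  if [pick B : {B | B \in K} | ij \in val B] is Some B then
    if block_coord k (val B) ij is Some u then p (b B) u else q
  else q.

Lemma entry_case_off (A : Type) (q : A) p (K : {set {set cell}})
    (b : {ffun {B | B \in K} -> 'I_m}) ij :
  ij \notin finset.cover K -> entry_case q p b ij = q.
Proof.
move=> ijK; rewrite /entry_case; case: pickP => // B ijB.
by move: ijK => /negP[]; apply/bigcupP; exists (val B) => //; exact: valP.
Qed.

(** On the listed elements [index] is injective. Membership in [B] puts both coordinates of each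
    cell in the enumerated projections. *)
Lemma block_coord_inj (B : {set cell}) ij ij' u : ij \in B -> ij' \in B ->
  block_coord k B ij = Some u -> block_coord k B ij' = Some u -> ij = ij'.
Proof.
have aux (S : {set 'I_n}) (x y : 'I_n) (v : 'I_k) : x \in S ->
    index x (enum S) = val v -> index y (enum S) = val v -> y \in S -> x = y.
  move=> xS xv yv yS; transitivity (nth x (enum S) (val v)).
    by rewrite -xv nth_index// mem_enum.
  by rewrite -yv nth_index// mem_enum.
move=> ijB ij'B; rewrite /block_coord.
case: insubP => // v _ v1; case: insubP => // w _ w1 [<-].
case: insubP => // v' _ v'1; case: insubP => // w' _ w'1 [vv' ww'].
move: v'1 w'1; rewrite vv' ww' => v'1 w'1.
rewrite (surjective_pairing ij) (surjective_pairing ij'); congr pair.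
- by apply: (aux [set p.1 | p in B]%SET _ _ v); rewrite ?imset_f.
- by apply: (aux [set p.2 | p in B]%SET _ _ w); rewrite ?imset_f.
Qed.

Lemma sum_block_coord (B : {set cell}) (f : 'I_k * 'I_k -> R) :
  (forall u, 0 <= f u) ->
  \sum_(ij in B) (if block_coord k B ij is Some u then f u else 0) <=
  \sum_u f u.
Proof.
move=> f0.
rewrite (eq_bigr (fun ij => \sum_(u | block_coord k B ij == Some u) f u)); last first.
  move=> ij _; case: (block_coord k B ij) => [u|]; last by rewrite big_pred0.
  by rewrite (big_pred1 u)// => v; rewrite /= eq_sym; apply: inj_eq => ? ? [].
rewrite (exchange_big_dep xpredT)//=; apply: ler_sum => u _.
rewrite sumr_const -[leRHS]mulr1n ler_wpMn2l//.
apply/card_le1P => ij /andP[ijB /eqP h] ij'.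
apply/idP/idP => [/andP[ij'B /eqP h']|/eqP->]; last first.
  by apply/andP; rewrite ijB h.
by apply/eqP; exact: block_coord_inj h' h.
Qed.

Definition meets (K K' : {set {set cell}}) : {set {set cell}} :=
  [set B in K | [exists B' in K', ~~ [disjoint B & B']]]%SET.

(* Block coordinates being injective, each block of [K] is charged at most its
   total divergence, however many blocks of [K'] it meets. *)
Lemma sum_entry_case (K K' : {set {set cell}}) (b : {ffun {B | B \in K} -> 'I_m})
    (ch : 'I_m -> 'I_k * 'I_k -> R) (t : R) :
  (forall l u, 0 <= ch l u) -> (forall l, \sum_u ch l u <= t) ->
  0 <= t ->
  \sum_(ij in finset.cover K') entry_case 0 ch b ij <= t * #|meets K K'|%:R.
Proof.
move=> ch0 cht t0.
pose h (B : {B | B \in K}) (ij : cell) : R :=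
  if block_coord k (val B) ij is Some u then ch (b B) u else 0.
have h0 B ij : 0 <= h B ij by rewrite /h; case: (block_coord _ _ _).
apply: (@le_trans _ _ (\sum_(ij in finset.cover K')
    \sum_(B : {B | B \in K} | ij \in val B) h B ij)).
  apply: ler_sum => ij _; rewrite /entry_case; case: pickP => [B ijB|_].
    by rewrite (bigD1 B)//= lerDl sumr_ge0.
  by rewrite sumr_ge0.
rewrite (exchange_big_dep xpredT)//=.
pose A := [set B : {B | B \in K} | val B \in meets K K']%SET.
apply: (@le_trans _ _ (\sum_(B in A) t)).
  rewrite [leRHS]big_mkcond/=; apply: ler_sum => B _; case: ifPn => BA.
    apply: le_trans (cht (b B)).
    apply: le_trans (sum_block_coord (val B) (ch0 (b B))).
    rewrite big_mkcond [leRHS]big_mkcond/=; apply: ler_sum => ij _.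
    rewrite -/(h B ij); case: (_ \in val B); rewrite ?andbF// ?andbT.
    by case: ifP.
  rewrite big_pred0// => ij; apply/negP => /andP[/bigcupP[B' B'K' ijB'] ijB].
  move/negP : BA; apply; rewrite inE/= inE (valP B)/=; apply/exists_inP.
  by exists B' => //; apply/pred0Pn; exists ij; rewrite /= ijB.
rewrite sumr_const mulr_natr ler_wpMn2l//.
rewrite -(card_imset _ val_inj); apply: subset_leq_card.
by apply/fintype.subsetP => _ /imsetP[B BA ->]; rewrite inE in BA.
Qed.

(** A cell outside one of the placements has one density equal to 1, so its integral is 1. On a
    common cell, [1 + y <= expR y] turns the bound of [integral_density_mul] into an exponent that
    adds up over cells. *)
Lemma entry_density_mul_le (Q : probability TR R)
    (P : 'I_m -> 'I_k * 'I_k -> probability TR R)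
    (l : 'I_m -> 'I_k * 'I_k -> TR -> R) (ch : 'I_m -> 'I_k * 'I_k -> R)
    (K K' : {set {set cell}}) (b : {ffun {B | B \in K} -> 'I_m})
    (b' : {ffun {B | B \in K'} -> 'I_m}) (ij : cell) :
  (forall i u, has_density (P i u) Q (l i u)) ->
  (forall i u, \int[Q]_x ((l i u x - 1) ^+ 2)%:E = (ch i u)%:E)%E ->
  (forall i u, 0 <= ch i u) ->
  (\int[Q]_x (entry_case (cst 1) l b ij x * entry_case (cst 1) l b' ij x)%:E <=
   (expR ((if ij \in finset.cover K' then entry_case 0 ch b ij else 0) / 2 +
          (if ij \in finset.cover K then entry_case 0 ch b' ij else 0) / 2))%:E)%E.
Proof.
move=> hl hch ch0.
have Q1 : has_density Q Q (cst 1).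
  by split => // F mF F0; apply: eq_integral => x _; rewrite mule1.
have E (J : {set {set cell}}) (e : {ffun {B | B \in J} -> 'I_m}) :
    [/\ has_density (entry_case Q P e ij) Q (entry_case (cst 1) l e ij),
     (\int[Q]_x ((entry_case (cst 1) l e ij x - 1) ^+ 2)%:E <=
       (entry_case 0 ch e ij)%:E)%E & 0 <= entry_case 0 ch e ij].
  have Q0 : (\int[Q]_x ((cst 1 x - 1) ^+ 2 : R)%:E <= 0%:E)%E.
    by rewrite integral0_eq// => x _; rewrite /= subrr expr0n.
  rewrite /entry_case; case: pickP => [B _|_]; last by split.
  case: (block_coord _ _ _) => [u|]; last by split.
  by split => //; rewrite hch.
have [h1 c1 p1] := E K b; have [h2 c2 p2] := E K' b'.
have one : (\int[Q]_x (1 : R)%:E = 1)%E by exact: density_integral1 Q1.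
case: ifPn => ijK'; last first.
  rewrite (entry_case_off (cst 1) l b' ijK') mul0r add0r.
  under eq_integral do rewrite /= mulr1.
  rewrite (density_integral1 h1) -expR0 lee_fin ler_expR.
  by case: ifP => _; rewrite ?divr_ge0.
case: ifPn => ijK; last first.
  rewrite (entry_case_off (cst 1) l b ijK) mul0r addr0.
  under eq_integral do rewrite /= mul1r.
  by rewrite (density_integral1 h2) -expR0 lee_fin ler_expR divr_ge0.
apply: le_trans (integral_density_mul h1 h2 c1 c2) _.
by rewrite lee_fin -mulrDl expR_ge1Dx.
Qed.

Lemma prode_le (I : finType) (f : I -> \bar R) (g : I -> R) :
  (forall i, (0 <= f i)%E) -> (forall i, (f i <= (g i)%:E)%E) ->
  (\prod_i f i <= (\prod_i g i)%:E)%E.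
Proof.
move=> f0 fg; pose r i := fine (f i).
have fE i : f i = (r i)%:E.
  rewrite /r fineK// ge0_fin_numE//.
  by apply: le_lt_trans (fg i) _; rewrite ltry.
rewrite [leLHS](eq_bigr (fun i => (r i)%:E)) => [|i _]; last exact: fE.
rewrite prodEFin lee_fin; apply: ler_prod => i _.
by rewrite -!lee_fin -fE f0 fg.
Qed.

(** Independence reduces the integral to a product over cells, and the exponents sum to half the
    cost of [K] on [K'] plus half the converse. The resulting bound no longer depends on the
    labelings. *)
Lemma law_H1_mul_le (Q : probability TR R)
    (P : 'I_m -> 'I_k * 'I_k -> probability TR R)
    (l : 'I_m -> 'I_k * 'I_k -> TR -> R) (ch : 'I_m -> 'I_k * 'I_k -> R)
    (K K' : {set {set cell}}) (b : {ffun {B | B \in K} -> 'I_m})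
    (b' : {ffun {B | B \in K'} -> 'I_m}) (x : R) : 0 <= x ->
  (forall i u, has_density (P i u) Q (l i u)) ->
  (forall i u, \int[Q]_x ((l i u x - 1) ^+ 2)%:E = (ch i u)%:E)%E ->
  (forall i u, 0 <= ch i u) -> (forall i, \sum_u ch i u <= ln (1 + x)) ->
  (\int[law_H0 n Q]_X (mx_density (entry_case (cst 1%R) l b) X *
     mx_density (entry_case (cst 1%R) l b') X)%:E <=
   (((1 + x) ^+ #|meets K K'| + (1 + x) ^+ #|meets K' K|) / 2)%:E)%E.
Proof.
move=> x0 hl hch ch0 cht.
have ml (J : {set {set cell}}) (e : {ffun {B | B \in J} -> 'I_m}) ij :
    measurable_fun setT (entry_case (cst 1%R) l e ij) /\
    forall y, 0 <= entry_case (cst 1%R) l e ij y.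
  have hm i u : measurable_fun setT (l i u) by case: (hl i u).
  have h0 i u y : 0 <= l i u y by case: (hl i u).
  rewrite /entry_case; case: pickP => [B _|_]; last by split.
  by case: (block_coord _ _ _) => [u|]; split.
rewrite (eq_integral (fun X => (mx_density (fun ij y =>
    entry_case (cst 1%R) l b ij y * entry_case (cst 1%R) l b' ij y) X)%:E));
  last by move=> X _; rewrite /mx_density -big_split.
rewrite integral_matrix_law_prod; first last.
- by move=> ij y; rewrite mulr_ge0 ?(ml _ _ _).2.
- by move=> ij; apply: measurable_funM; exact: (ml _ _ _).1.
apply: le_trans (prode_le _ (fun ij => entry_density_mul_le b b' ij hl hch ch0)) _.
  move=> ij; apply: integral_ge0 => y _.
  by rewrite lee_fin mulr_ge0 ?(ml _ _ _).2.
rewrite lee_fin -expR_sum big_split/= -!mulr_suml -!big_mkcond/=.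
have t0 : 0 <= ln (1 + x) by rewrite ln_ge0// lerDl.
have s1 := sum_entry_case K' b ch0 cht t0.
have s2 := sum_entry_case K b' ch0 cht t0.
have x1 : 0 < 1 + x by rewrite ltr_pwDl.
set s := \sum_(_ in _) _ in s1 *; set s' := \sum_(_ in _) _ in s2 *.
have e1 : expR s <= (1 + x) ^+ #|meets K K'|.
  by rewrite -[X in X ^+ _](lnK (x := 1 + x))// -expRM_natr ler_expR.
have e2 : expR s' <= (1 + x) ^+ #|meets K' K|.
  by rewrite -[X in X ^+ _](lnK (x := 1 + x))// -expRM_natr ler_expR.
rewrite expRD.
have q (z : R) : expR z = expR (z / 2) ^+ 2.
  by rewrite -expRM_natl mulrC divfK// pnatr_eq0.
rewrite (q s) in e1; rewrite (q s') in e2.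
exact: ler_mul_mean_sqr.
Qed.

Lemma labelings_gt0 (K : {set {set cell}}) : #|K| = m ->
  (0 < #|labelings m K|)%N.
Proof.
move=> Km.
have cK : #|{: {B | B \in K}}| = m by rewrite card_sig -Km.
apply/card_gt0P; exists [ffun B => cast_ord cK (enum_rank B)].
rewrite inE; apply/andP; split.
  apply/injectiveP => B B'; rewrite !ffunE => /cast_ord_inj; exact: enum_rank_inj.
apply/forallP => i; apply/codomP.
by exists (enum_val (cast_ord (esym cK) i)); rewrite ffunE enum_valK cast_ordKV.
Qed.

End model_second_moment.

Lemma avg_le (R : realType) (I : finType) (A : {set I}) (f : I -> R) (c : R) :
  (0 < #|A|)%N -> (forall i, i \in A -> f i <= c) -> avg A f <= c.
Proof.
move=> A0 fc; have A0' : 0 < #|A|%:R :> R by rewrite ltr0n.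
rewrite /avg ler_pdivrMl//; apply: le_trans (ler_sum _ fc) _.
by rewrite sumr_const mulr_natl.
Qed.

(** * Second moment under consecutive placements *)

Section law_H1.
Context (R : realType) (n m k : nat).
Local Notation TR := (measurableTypeR R).
Variables (Q : probability TR R) (P : 'I_m -> 'I_k * 'I_k -> probability TR R).
Variable x : R.
Hypotheses (m0 : (0 < m)%N) (k0 : (0 < k)%N) (kn : (k <= n)%N) (x0 : 0 <= x).
Hypothesis room : (4 * k ^ 2 * m < (n - k).+1 ^ 2)%N.

Lemma placements_con_gt0 : (0 < #|placements_con n m k|)%N.
Proof.
rewrite placements_conE.
apply: (@packings_gt0 _ _ _ _ ((n - k).+1 ^ 2 - 4 * k ^ 2 * m) m) => //.
- by move=> B B'; rewrite disjoint_sym.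
- by rewrite subn_gt0.
move=> j K jm KP.
apply: leq_trans (available_ge (c := 4 * k ^ 2) _ _ KP).
- by rewrite card_blocks_con// leq_sub2l// leq_mul2l (ltnW jm) orbT.
- by move=> b bD; apply: block_con_neq0 bD.
- by move=> b bD; apply: card_block_con_conflicts bD.
Qed.

(** The numerator is the total weight of all block positions when [4 * k ^ 2 * m] of them weigh
    [1 + x]; the denominator is the guaranteed number of free positions at every step. *)
Definition second_moment_bound : R :=
  ((((n - k).+1 ^ 2)%:R + x * (4 * k ^ 2 * m)%:R) /
   ((n - k).+1 ^ 2 - 4 * k ^ 2 * m)%:R) ^+ m.

Lemma avg_meets_le K' : K' \in placements_con n m k ->
  avg (placements_con n m k) (fun K => (1 + x) ^+ #|meets K K'|) <=
  second_moment_bound.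
Proof.
move=> K'P; have P0 : 0 < #|placements_con n m k|%:R :> R.
  by rewrite ltr0n placements_con_gt0.
rewrite /avg ler_pdivrMl// mulrC /second_moment_bound -card_blocks_con//.
rewrite placements_conE in K'P *; apply: packings_mgf => //.
- by move=> B B'; rewrite disjoint_sym.
- by move=> b bD; apply: block_con_neq0 bD.
- by move=> b bD; apply: card_block_con_conflicts bD.
- by rewrite card_blocks_con.
Qed.

Hypothesis PQ : forall l u, P l u `<< Q.
Hypothesis HTheta : (Theta_star Q P <= ((k ^ 2)%:R^-1 * ln (1 + x))%:E)%E.

Lemma law_H1_density : exists L : obs R n -> R,
  [/\ set_density (law_H1 n Q P) (law_H0 n Q) L, law_H1 n Q P setT = 1%E &
   (\int[law_H0 n Q]_X (L X * L X)%:E <= second_moment_bound%:E)%E].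
Proof.
have [ch [ch0 chE chS]] := Theta_star_chi2 m0 k0 HTheta.
have k20 : (k ^ 2)%:R != 0 :> R by rewrite pnatr_eq0 -lt0n expn_gt0 k0.
have cht i : \sum_u ch i u <= ln (1 + x).
  by have := chS i; rewrite mulVKf.
have /choice[l hl] : forall iu : 'I_m * ('I_k * 'I_k), exists l,
    has_density (P iu.1 iu.2) Q l /\
    (\int[Q]_y ((l y - 1) ^+ 2)%:E = (ch iu.1 iu.2)%:E)%E.
  move=> [i u]; have [l h e] := radon_nikodym_density (PQ i u).
  by exists l; split => //=; rewrite -chE.
pose l' i u := l (i, u).
have hl1 i u : has_density (P i u) Q (l' i u) by case: (hl (i, u)).
have hl2 i u : (\int[Q]_y ((l' i u y - 1) ^+ 2)%:E = (ch i u)%:E)%E.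
  by case: (hl (i, u)).
have Q1 : has_density Q Q (cst 1).
  by split => // F mF F0; apply: eq_integral => y _; rewrite mule1.
pose LKb (K : {set {set 'I_n * 'I_n}}) (b : {ffun {B | B \in K} -> 'I_m}) :=
  mx_density (entry_case (cst 1%R) l' b).
pose LK K X := avg (labelings m K) (fun b => LKb K b X).
have dKb (K : {set {set 'I_n * 'I_n}}) (b : {ffun {B | B \in K} -> 'I_m}) :
    set_density (matrix_law (entry_law Q P b)) (law_H0 n Q) (LKb K b).
  apply: has_density_set; apply: matrix_law_density => ij.
  rewrite /entry_law /entry_case; case: pickP => [B _|_] //.
  by case: (block_coord _ _ _).
have dK (K : {set {set 'I_n * 'I_n}}) : set_density
    (mixture (labelings m K) (fun b => matrix_law (entry_law Q P b)))
    (law_H0 n Q) (LK K).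
  exact: (mixture_density (nu := fun b => matrix_law (entry_law Q P b))
    (labelings m K) (dKb K)).
have mKb (K : {set {set 'I_n * 'I_n}}) (b : {ffun {B | B \in K} -> 'I_m}) :
    measurable_fun setT (LKb K b).
  by case: (dKb K b).
have KB0 (K : {set {set 'I_n * 'I_n}}) (b : {ffun {B | B \in K} -> 'I_m}) X :
    0 <= LKb K b X.
  by case: (dKb K b).
have mK K : measurable_fun setT (LK K) by case: (dK K).
have K0 K X : 0 <= LK K X by case: (dK K).
have P0 := placements_con_gt0.
have cardK K : K \in placements_con n m k -> #|K| = m.
  by rewrite placements_conE => /packingsP[].
exists (fun X => avg (placements_con n m k) (fun K => LK K X)); split.
- exact: (mixture_density (nu := fun K => mixture (labelings m K)
    (fun b => matrix_law (entry_law Q P b))) (placements_con n m k) dK).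
- apply: mixture_prob => // K /cardK Km; apply: mixture_prob.
    exact: labelings_gt0.
  by move=> b _; exact: probability_setT.
pose g K K' : R := (1 + x) ^+ #|@meets n K K'|.
apply: (@le_trans _ _ (avg (placements_con n m k) (fun K =>
    avg (placements_con n m k) (fun K' => (g K K' + g K' K) / 2)))%:E).
  apply: avg_second_moment => // K K' KP K'P.
  apply: (@le_trans _ _ (avg (labelings m K) (fun b =>
      avg (labelings m K') (fun b' => (g K K' + g K' K) / 2)))%:E).
    apply: avg_second_moment => // b b' _ _.
    exact: law_H1_mul_le hl1 hl2 ch0 cht.
  rewrite lee_fin; apply: avg_le; first exact/labelings_gt0/cardK.
  by move=> b _; apply: avg_le => //; exact/labelings_gt0/cardK.
rewrite lee_fin.
(* Both placements range over the same set, so exchanging the sums identifies the averages of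
   [g K K'] and [g K' K]. It remains to average over [K] for fixed [K']. *)
have -> : avg (placements_con n m k) (fun K =>
    avg (placements_con n m k) (fun K' => (g K K' + g K' K) / 2)) =
    avg (placements_con n m k) (fun K' =>
      avg (placements_con n m k) (fun K => g K K')).
  rewrite /avg -!mulr_sumr; congr (_ * (_ * _)).
  under eq_bigr do rewrite -mulr_suml big_split/=.
  rewrite -mulr_suml big_split/= [X in (X + _) / 2]exchange_big/=.
  by rewrite mulrDl -splitr.
by apply: avg_le => // K' K'P; exact: avg_meets_le.
Qed.

End law_H1.

(** * Asymptotics *)

(** Since [k <= m * k <= n / 4], there are at least [9 n^2 / 16] positions, of which at most
    [n^2 / 4] are lost. *)
Lemma free_positions_ge (n m k : nat) : (0 < m)%N -> (4 * (m * k) <= n)%N ->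
  (n ^ 2 <= 4 * ((n - k).+1 ^ 2 - 4 * k ^ 2 * m))%N.
Proof.
move=> m0 mkn.
have kmk : (k <= m * k)%N by rewrite leq_pmull.
have h1 : (4 * k ^ 2 * m * 4 <= n ^ 2)%N.
  by apply: leq_trans (leq_mul mkn mkn) => //; rewrite -!mulnn; nia.
have h2 : (3 * n <= 4 * (n - k).+1)%N by lia.
have h3 := leq_mul h2 h2.
by rewrite -!mulnn in h1 h3 *; nia.
Qed.

(** With [D >= n^2 / 4] free positions the base is [1 + z], where [z = (1 + x) 4 k^2 m / D], and
    [(1 + z)^m <= exp(m z)]. The given [x] is scaled so that its share of the exponent is exactly
    [4 l]. *)
Lemma second_moment_bound_le (R : realType) (n m k : nat) (l : R) :
  (0 < n)%N -> (0 < m)%N -> (0 < k)%N -> (4 * (m * k) <= n)%N -> 0 <= l ->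
  second_moment_bound n m k
    ((n ^ 2)%:R * l / (4 * (k ^ 2)%:R * (m ^ 2)%:R)) <=
  expR (16 * ((m * k)%:R / n%:R) ^+ 2 + 4 * l).
Proof.
move=> n0 m0 k0 mkn l0; rewrite /second_moment_bound.
have room := free_positions_ge m0 mkn.
set N := ((n - k).+1 ^ 2)%N in room *.
set D := (N - 4 * k ^ 2 * m)%N in room *.
have n20 : (0 < n ^ 2)%N by rewrite expn_gt0 n0.
have D0 : (0 < D)%N by lia.
have nR : 0 < n%:R :> R by rewrite ltr0n.
have mR : 0 < m%:R :> R by rewrite ltr0n.
have kR : 0 < k%:R :> R by rewrite ltr0n.
have DR : 0 < D%:R :> R by rewrite ltr0n.
have DnR : n%:R ^+ 2 / 4 <= D%:R :> R.
  rewrite ler_pdivrMr// -natrX -(natrM _ D 4) ler_nat; lia.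
set x := _ * l / _.
have x0 : 0 <= x by rewrite /x divr_ge0 ?mulr_ge0.
have -> : N%:R + x * (4 * k ^ 2 * m)%:R =
    D%:R * (1 + (1 + x) * (4 * k ^ 2 * m)%:R / D%:R) :> R.
  have -> : N = (D + 4 * k ^ 2 * m)%N by lia.
  rewrite natrD; move: (4 * _ * _)%N => c; field.
  by rewrite gt_eqF.
rewrite mulrAC mulfV ?gt_eqF// mul1r.
set z := _ * _ / D%:R.
have z0 : 0 <= z by rewrite divr_ge0 ?mulr_ge0 ?addr_ge0.
apply: (@le_trans _ _ (expR z ^+ m)).
  by apply: lerXn2r; rewrite ?nnegrE ?addr_ge0 ?expR_ge0 ?expR_ge1Dx.
rewrite -expRM_natl ler_expR.
have -> : 16 * ((m * k)%:R / n%:R) ^+ 2 + 4 * l =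
    m%:R * ((1 + x) * (4 * k ^ 2 * m)%:R / (n%:R ^+ 2 / 4)).
  rewrite /x !natrX !natrM; field.
  by rewrite !gt_eqF.
apply: ler_wpM2l => //; apply: ler_wpM2l; first by rewrite mulr_ge0 ?addr_ge0.
by rewrite lef_pV2 ?posrE// divr_gt0 ?exprn_gt0.
Qed.

Lemma cvge_dist_le (R : realType) (f : nat -> \bar R) (a : R) :
  (forall e : R, 0 < e ->
    \forall n \near \oo, ((a - e)%:E <= f n <= (a + e)%:E)%E) ->
  f @ \oo --> a%:E.
Proof.
move=> h; apply/fine_cvgP; split.
  apply: filterS (h 1 ltr01) => n /andP[h1 h2]; rewrite fin_numElt.
  by rewrite (lt_le_trans _ h1) ?ltNyr// (le_lt_trans h2) ?ltry.
apply/cvgrPdist_le => e e0; apply: filterS (h e e0) => n /=.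
case: (f n) => [r|/andP[]|/andP[]]//.
by rewrite !lee_fin ler_distlC.
Qed.

Theorem corollary4 (R : realType) (m k : nat -> nat) (delta : nat -> R)
    (P : forall n : nat, 'I_(m n) -> 'I_(k n) * 'I_(k n) ->
      probability (measurableTypeR R) R)
    (Hmk : forall n : nat, (0 < n)%N ->
      [/\ (0 < m n)%N, (0 < k n)%N & (m n * k n <= n)%N])
    (HP : forall n : nat, (0 < n)%N -> forall l u, P n l u `<< std_normal R)
    (Hdelta_gt0 : forall n : nat, (0 < n)%N -> 0 < delta n)
    (Hdelta : delta @ \oo --> 0)
    (Hmk_o : (fun n => (m n * k n)%:R : R^o) =o_\oo (fun n => n%:R : R^o))
    (HTheta : forall n : nat, (0 < n)%N ->
      (Theta_star (std_normal R) (P n) <=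
       (((k n ^ 2)%:R)^-1 *
        ln (1 + (n ^ 2)%:R * ln (1 + delta n)
                / (4 * (k n ^ 2)%:R * (m n ^ 2)%:R)))%:E)%E) :
  dTV (law_H0 n (std_normal R)) (law_H1 n (std_normal R) (P n)) @[n --> \oo] --> 0%E /\
  min_risk (law_H0 n (std_normal R)) (law_H1 n (std_normal R) (P n)) @[n --> \oo] --> 1%E.
Proof.
have key (e : R) : 0 < e -> \forall n \near \oo,
    law_H1 n (std_normal R) (P n) setT = 1%E /\
    forall U, measurable U ->
      (law_H1 n (std_normal R) (P n) U <= law_H0 n (std_normal R) U + e%:E)%E /\
      (law_H0 n (std_normal R) U <= law_H1 n (std_normal R) (P n) U + e%:E)%E.
  (* A second moment of at most [1 + e ^+ 2 = expR tau] yields closeness [e], by [set_density_close]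
     with [eta = e] and [s = e ^+ 2]. *)
  move=> e0; pose tau := ln (1 + e ^+ 2).
  have tau0 : 0 < tau by rewrite ln_gt0// ltrDl exprn_gt0.
  (* The bound [c <= 1/4] gives [4 m k <= n] and [16 c^2 <= 4 c]. With [c <= tau / 32] and
     [delta n <= tau / 8], the exponent is at most [tau / 8 + tau / 2 < tau]. *)
  pose c := Num.min (4^-1) (tau / 32).
  have c0 : 0 < c by rewrite lt_min invr_gt0 ltr0n divr_gt0.
  have c4 : c <= 4^-1 by rewrite ge_min lexx.
  have ctau : c <= tau / 32 by rewrite ge_min lexx orbT.
  near=> n.
  have n0 : (0 < n)%N by near: n; exists 1%N.
  have [m0 k0 mkn] := Hmk n n0.
  have nR : 0 < n%:R :> R by rewrite ltr0n.
  have d0 := Hdelta_gt0 n n0.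
  have dtau : delta n <= tau / 8.
    apply: le_trans (ler_norm _) _.
    by near: n; apply: (cvgr0_norm_le _ Hdelta); exact: divr_gt0.
  have mkc : (m n * k n)%:R <= c * n%:R :> R.
    have : `|(m n * k n)%:R : R^o| <= c * `|n%:R : R^o|.
      near: n; have /eqoP := Hmk_o; exact.
    by rewrite !normr_nat.
  have mk4 : (4 * (m n * k n) <= n)%N.
    by rewrite -(ler_nat R) natrM; nra.
  have kn : (k n <= n)%N by exact: leq_trans (leq_pmull _ m0) mkn.
  have room : (4 * k n ^ 2 * m n < (n - k n).+1 ^ 2)%N.
    rewrite -subn_gt0 -(@ltn_pmul2l 4)// muln0.
    by apply: leq_trans (free_positions_ge m0 mk4); rewrite expn_gt0 n0.
  have l0 : 0 <= ln (1 + delta n) by rewrite ln_ge0// lerDl ltW.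
  have ld : ln (1 + delta n) <= delta n.
    by rewrite le_ln1Dx// (lt_trans _ d0)// ltrN10.
  set x := (n ^ 2)%:R * ln (1 + delta n) / (4 * (k n ^ 2)%:R * (m n ^ 2)%:R).
  have x0 : 0 <= x by rewrite divr_ge0 ?mulr_ge0.
  have [L [hL T1 L2]] := law_H1_density m0 k0 kn x0 room (HP n n0) (HTheta n n0).
  split => // U mU.
  have -> : e = (e + e ^+ 2 / e) / 2 by field; rewrite gt_eqF.
  apply: (set_density_close hL T1 e0) => //.
  apply: le_trans L2 _; rewrite lee_fin.
  apply: le_trans (second_moment_bound_le n0 m0 k0 mk4 l0) _.
  have -> : 1 + e ^+ 2 = expR tau by rewrite lnK// posrE ltr_pwDl// sqr_ge0.
  rewrite ler_expR.
  have q0 : 0 <= (m n * k n)%:R / n%:R :> R by rewrite divr_ge0.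
  have qc : (m n * k n)%:R / n%:R <= c :> R by rewrite ler_pdivrMr.
  move: q0 qc; move: (_ / n%:R) => q q0 qc.
  have : 16 * q ^+ 2 <= 4 * c by nra.
  lra.
split; apply: cvge_dist_le => e e0; apply: filterS (key e e0) => n [T1 close].
- rewrite sub0r add0r; apply/andP; split.
    by apply: le_trans (dTV_ge0 _ _); rewrite lee_fin oppr_le0 ltW.
  exact: dTV_le.
- apply/andP; split; first exact: min_risk_ge.
  apply: (@le_trans _ _ 1%E); first exact: min_risk_le1.
  by rewrite lee_fin lerDl ltW.
Unshelve. all: by end_near.
Qed.
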